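(* Let $M_1,\dots,M_m$ be smooth manifolds, let $\mu_1,\dots,\mu_m$ be compactly supported Borel probability measures on $M_1,\dots,M_m$ respectively, and let $c:M_1\times\cdots\times M_m\to\mathbb{R}$ be a continuous, semi-concave cost function. Assume that $c$ is twisted in $c$-cyclical monotonicity and that $\mu_1$ is absolutely continuous with respect to local coordinates. Then the solution $\gamma$ of the problem of minimizing $\int_{M_1\times\cdots\times M_m} c(x_1,\dots,x_m)\,d\gamma$ among probability measures $\gamma$ on $M_1\times\cdots\times M_m$ which project to the $\mu_i$ induces a Monge solution, i.e. it is concentrated on the graph $\{(x_1,T(x_1))\}$ of a function $T:M_1\to M_2\times\cdots\times M_m$, and this solution $\gamma$ is unique.
   Context: A set $S\subseteq M_1\times\cdots\times M_m$ is \emph{$c$-cyclically monotone} if for any finite subset $\{(x_1^1,\dots,x_m^1),\dots,(x_1^N,\dots,x_m^N)\}\subseteq S$ and any $m$ permutations $\sigma_1,\dots,\sigma_m$ on $N$ letters, $$\sum_{i=1}^N c(x_1^i,x_2^i,\dots,x_m^i)\le\sum_{i=1}^N c(x_1^{\sigma_1(i)},x_2^{\sigma_2(i)},\dots,x_m^{\sigma_m(i)}).$$ A continuous, semi-concave cost $c$ is \emph{twisted in $c$-cyclical monotonicity} if for each fixed $x_1\in M_1$ and each $c$-cyclically monotone set $S\subseteq\{x_1\}\times M_2\times\cdots\times M_m$, the map $(x_2,\dots,x_m)\mapsto D_{x_1}c(x_1,x_2,\dots,x_m)$ is injective on the subset of $S$ where $c$ is differentiable with respect to $x_1$ (i.e.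 the subset where $D_{x_1}c(x_1,x_2,\dots,x_m)$ exists). ``Absolutely continuous with respect to local coordinates'' means absolutely continuous with respect to Lebesgue measure in local coordinate charts. *)

(* Defs.v *)
From HB Require Import structures.
From mathcomp Require Import all_boot all_order all_algebra all_fingroup.
From mathcomp Require Import all_classical all_reals all_analysis.

Set Implicit Arguments.
Unset Strict Implicit.
Unset Printing Implicit Defensive.

Import Order.TTheory GRing.Theory Num.Theory.
Import numFieldNormedType.Exports.

Local Open Scope classical_set_scope.
Local Open Scope ring_scope.

(* f is of class C^k on the open set U; partial derivatives are directional
   derivatives along the canonical basis. *)
Fixpoint Ck_on (R : realType) (k n p : nat) (U : set 'rV[R]_n)
    (f : 'rV[R]_n -> 'rV[R]_p) : Prop :=
  {in U, continuous f} /\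
  if k is k'.+1 then
    forall i : 'I_n,
      {in U, forall x, derivable f x (delta_mx ord0 i)} /\
      Ck_on k' U (fun x => 'D_(delta_mx ord0 i) f x)
  else True.

Definition smooth_on (R : realType) (n p : nat) (U : set 'rV[R]_n)
    (f : 'rV[R]_n -> 'rV[R]_p) : Prop := forall k, Ck_on k U f.

(* chart_map and chart_inv are total functions, meaningful only on chart_dom
   and chart_cod; both sets are open, so continuity at their points does not
   depend on the values elsewhere. *)
Record chart (R : realType) (n : nat) (T : topologicalType) := Chart {
  chart_dom : set T;
  chart_map :> T -> 'rV[R]_n;
  chart_inv : 'rV[R]_n -> T;
  chart_cod := chart_map @` chart_dom;
  chart_dom_open : open chart_dom;
  chart_cod_open : open chart_cod;
  chart_mapK : {in chart_dom, cancel chart_map chart_inv};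
  chart_map_continuous : {in chart_dom, continuous chart_map};
  chart_inv_continuous : {in chart_cod, continuous chart_inv} }.

Record smoothManifold (R : realType) := SmoothManifold {
  (* pointed, as required of a measurableType; a manifold carrying a
     probability measure is nonempty anyway *)
  manifold_sort :> ptopologicalType;
  manifold_dim : nat;
  atlas : set (chart R manifold_dim manifold_sort);
  manifold_hausdorff : hausdorff_space manifold_sort;
  manifold_second_countable : @second_countable manifold_sort;
  atlas_cover : forall x : manifold_sort, exists2 e, atlas e & chart_dom e x;
  atlas_smooth : forall e e', atlas e -> atlas e' ->
    smooth_on (e @` (chart_dom e `&` chart_dom e')) (e' \o chart_inv e) }.

Definition borel (T : ptopologicalType) : measurableType (sigma_display (@open T)) :=
  g_sigma_algebraType (@open T).

Definition mprod (R : realType) (m : nat) (M : 'I_m -> smoothManifold R) : Type :=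
  prod_topology (fun i => M i : topologicalType).

HB.instance Definition _ (R : realType) (m : nat) (M : 'I_m -> smoothManifold R) :=
  Topological.on (mprod M).
HB.instance Definition _ (R : realType) (m : nat) (M : 'I_m -> smoothManifold R) :=
  isPointed.Build (mprod M) (fun i => point : M i).

(* On Borel sets this is n-dimensional Lebesgue measure: the successor case
   is the library's formula for the product measure of Lebesgue measure on R
   and Lebesgue measure on R^n, and on R^0 it is the unit mass. *)
Fixpoint lebesgue_rV (R : realType) (n : nat) : set 'rV[R]_n -> \bar R :=
  match n with
  | 0 => fun A => (\1_A (0 : 'rV[R]_0))%:E
  | n'.+1 => fun A =>
      (\int[@lebesgue_measure R]_x
         lebesgue_rV [set v : 'rV[R]_n' | A (row_mx (x%:M : 'rV[R]_1) v)])%E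
  end.

Section Measures.
Context (R : realType).

Definition ac_in_charts (M : smoothManifold R) (mu : probability (borel M) R) :=
  forall e : chart R (manifold_dim M) M, atlas e ->
  forall A : set (borel 'rV[R]_(manifold_dim M)), measurable A -> lebesgue_rV A = 0%E ->
  mu (chart_dom e `&` e @^-1` A) = 0%E.

Definition msupport (T : ptopologicalType) (mu : probability (borel T) R) : set T :=
  [set x | forall U, open_nbhs x U -> (0 < mu U)%E].

Definition compactly_supported (T : ptopologicalType)
  (mu : probability (borel T) R) := compact (msupport mu).

End Measures.

Section Cost.
Context (R : realType) (m : nat) (M : 'I_m.+1 -> smoothManifold R).
Implicit Types (c : mprod M -> R).

(* The N points need not be distinct. *)
Definition c_cyclically_monotone c (S : set (mprod M)) :=
  forall (N : nat) (x : 'I_N -> mprod M) (s : 'I_m.+1 -> 'S_N),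
  (forall i, S (x i)) ->
  \sum_(i < N) c (x i) <= \sum_(i < N) c (fun j => x (s j i) j).

(* c read in the product of the charts e i, on R^(dim M_1 + ... + dim M_m) *)
Definition in_charts c (e : forall i, chart R (manifold_dim (M i)) (M i))
    (v : 'rV[R]_(\sum_i manifold_dim (M i))) : R :=
  c (fun i => chart_inv (e i) (submxrow v i)).

Definition sqnorm (n : nat) (v : 'rV[R]_n) : R := \sum_i v ord0 i ^+ 2.

(* Near every point, in local coordinates, c - K |.|^2 is concave for some K;
   being free to shrink r, the ball may be assumed to lie in the image of the
   product chart. *)
Definition semiconcave c :=
  forall (x : mprod M) (e : forall i, chart R (manifold_dim (M i)) (M i)),
  (forall i, atlas (e i) /\ chart_dom (e i) (x i)) ->
  exists (K r : R), 0 < r /\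
    convex_function (ball (\mxrow_i e i (x i)) r)
      (fun v => K * sqnorm v - in_charts c e v).

(* x_1 |-> c(x_1, x_2, ..., x_m) read in the chart e of M_1 *)
Definition slice1 c (e : chart R (manifold_dim (M ord0)) (M ord0)) (x : mprod M)
    (p : 'rV[R]_(manifold_dim (M ord0))) : R :=
  c (@dfwith 'I_m.+1 (fun i => M i) x ord0 (chart_inv e p)).

(* The covector D_{x_1}c at x_1 is represented by the differential of
   slice1 in a chart around x_1; whether it exists, and whether two of them
   coincide, does not depend on the chart. *)
Definition twisted c :=
  forall (x1 : M ord0) (S : set (mprod M)),
  (forall x, S x -> x ord0 = x1) -> c_cyclically_monotone c S ->
  forall e : chart R (manifold_dim (M ord0)) (M ord0), atlas e -> chart_dom e x1 ->
  forall x y : mprod M, S x -> S y ->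
  differentiable (slice1 c e x) (e x1) ->
  differentiable (slice1 c e y) (e x1) ->
  'd (slice1 c e x) (e x1) = 'd (slice1 c e y) (e x1) :> (_ -> _) ->
  x = y.

Definition coupling (mu : forall i, probability (borel (M i)) R)
    (gamma : probability (borel (mprod M)) R) :=
  forall i (A : set (borel (M i))), measurable A ->
    gamma ((fun x : mprod M => x i) @^-1` A) = mu i A.

Definition kantorovich_solution c (mu : forall i, probability (borel (M i)) R)
    (gamma : probability (borel (mprod M)) R) :=
  coupling mu gamma /\
  forall gamma' : probability (borel (mprod M)) R, coupling mu gamma' ->
    (\int[gamma]_x (c x)%:E <= \int[gamma']_x (c x)%:E)%E.

(* lift ord0 j is the index j + 1, so T takes values in M_2 x ... x M_m *)
Definition graph (T : M ord0 -> forall j : 'I_m, M (lift ord0 j)) :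
    set (mprod M) :=
  [set x : mprod M | forall j, x (lift ord0 j) = T (x ord0) j].

Definition induces_monge (gamma : probability (borel (mprod M)) R) :=
  exists T, gamma.-negligible (~` graph T).

End Cost.

(* Main.v *)
(* Let K be the product of the supports, which is compact.  On bounded functions
   on K, the infimum p(f) of the sums of the integrals of the u_i over the
   families with f <= u_1 + ... + u_m on K is sublinear, and Hahn-Banach gives a
   linear L <= p with L(-c) = p(-c).  Evaluating L on indicators gives a finitely
   additive charge with marginals mu_i; it is regular on boxes, so it extends to
   a plan gamma, whose cost is -p(-c).  The dual problem is attained: conjugates
   inherit the modulus of continuity of c, so a maximizing sequence of families
   converges along an ultrafilter.
     Every optimal plan is thus carried by the set W where u_1 + ... + u_m = c,
   which is c-cyclically monotone.  Over a point x_1, the function u_1 touches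
   the slices c(., x_2, ..., x_m) from below at the points of W, and the slices
   are semiconcave.  Unless the right slope of u_1 along some axis is smaller
   than the left one, all these slices are differentiable at x_1 with the same
   differential.  Such kinks are isolated, uniformly in the slopes and in the
   scale, on lines parallel to the axis, so they form a null set N by Fubini.
   Twistedness then makes the projection of W to M_1 injective away from N.  So
   an optimal plan lives on a graph over M_1 and, for A closed, gives A the
   mass mu_1 (pi_1 (W n A)), whence uniqueness. *)
From HB Require Import structures.
Require Import Defs.
From mathcomp Require Import all_boot all_order all_algebra all_fingroup.
From mathcomp Require Import all_classical all_reals all_analysis.
From mathcomp Require Import measurable_realfun finmap ring lra.
Import numFieldNormedType.Exports.

Set Implicit Arguments.
Unset Strict Implicit.
Unset Printing Implicit Defensive.

Import Order.TTheory GRing.Theory Num.Theory.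

Local Open Scope classical_set_scope.
Local Open Scope ring_scope.

(** * Hahn-Banach and extension of finitely additive charges *)

(** [L] acts on all bounded functions, so it can be evaluated on the indicator of any set, and
    measurability matters only once the charge is extended. Passing to - c turns the minimization
    into a domination from above. The touching argument needs u_1 on a full chart neighbourhood of
    x_1, which may leave the support of mu_1. Conjugates are therefore infima over K in the other
    variables, but are defined at every point of the manifold. No differentiability of u_1 is used.
    Where u_1 touches a semiconcave f from below, its upper right slope is at most the right slope
    of f, which is at most the left slope of f, which is at most the lower left slope of u_1.
    Without a gap between the outer terms f has a two-sided slope along every axis, and since K|.|^2
    - f is convex this is already differentiability. A gap contains two rationals a < b and shows at
    some scale 1/(k+1), which leaves countably many sets to consider. *)

Section HahnBanach.
Context (R : realType) (V : lmodType R) (D : set V).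
Hypotheses (D0 : D 0) (DD : forall x y, D x -> D y -> D (x + y))
  (DZ : forall (t : R) x, D x -> D (t *: x)).

(** Everything is relative to a subspace given as the predicate [D], so that the bounded functions
    need no type of their own. *)
Definition sublinear (q : V -> R) :=
  (forall x y, D x -> D y -> q (x + y) <= q x + q y) /\
  (forall t x, 0 <= t -> D x -> q (t *: x) = t * q x).

Let DN x : D x -> D (- x). Proof. by move=> Dx; rewrite -scaleN1r; exact: DZ. Qed.

Lemma sublinear0 q : sublinear q -> q 0 = 0.
Proof. by case=> _ qZ; rewrite -(scale0r 0) qZ// mul0r. Qed.

Lemma sublinear_geN q x : sublinear q -> D x -> - q (- x) <= q x.
Proof.
move=> qs Dx; rewrite lerNl -subr_ge0 opprK -(sublinear0 qs) -(addNr x).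
by apply: qs.1 => //; exact: DN.
Qed.

(** The infimum over t >= 0 of q (g + t f) - t q f; the last inequality is t = 1. At g = - f it
    forces r (- f) <= - q f, and when q is minimal it gives q g + q f <= q (g + f). *)
Lemma sublinear_shift q f : sublinear q -> D f ->
  exists r, [/\ sublinear r, forall g, D g -> r g <= q g &
                forall g, D g -> r g <= q (g + f) - q f].
Proof.
move=> qs Df; have [qD qZ] := qs.
pose S g := [set q (g + t *: f) - t * q f | t in [set t | 0 <= t]].
have Slb g : D g -> lbound (S g) (- q (- g)).
  move=> Dg _ [t /= t0 <-]; rewrite -qZ// lerBrDr addrC.
  rewrite -{1}[t *: f](addrK g) [t *: f + g]addrC lerBlDr.
  by apply: qD; [apply: DD => //; exact: DZ | exact: DN].
have Sinf g : D g -> has_inf (S g).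
  move=> Dg; split; last by exists (- q (- g)); exact: Slb.
  by exists (q (g + 0 *: f) - 0 * q f), 0 => /=.
pose r g := inf (S g).
have rle g t : D g -> 0 <= t -> r g <= q (g + t *: f) - t * q f.
  by move=> Dg t0; apply: ge_inf; [exact: (Sinf _ Dg).2 | exists t].
exists r; split; first split.
- move=> x y Dx Dy; rewrite -lerBlDr; apply: lb_le_inf; first exact: (Sinf x Dx).1.
  move=> _ [s /= s0 <-]; rewrite lerBlDr -lerBlDl.
  apply: lb_le_inf; first exact: (Sinf y Dy).1.
  move=> _ [t /= t0 <-]; rewrite lerBlDl.
  apply: (le_trans (rle (x + y) (s + t) _ _)); [exact: DD|exact: addr_ge0|].
  have := qD _ _ (DD Dx (DZ s Df)) (DD Dy (DZ t Df)).
  by rewrite addrACA -scalerDl; lra.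
- move=> t x t0 Dx.
  have rle' s y : 0 <= s -> D y -> r (s *: y) <= s * r y.
    rewrite le_eqVlt => /predU1P[<- Dy|s0 Dy].
      rewrite scale0r mul0r (le_trans (rle 0 0 _ _))//.
      by rewrite scale0r addr0 mul0r subr0 (sublinear0 qs).
    rewrite -ler_pdivrMl//; apply: lb_le_inf; first exact: (Sinf y Dy).1.
    move=> _ [u /= u0 <-]; rewrite ler_pdivrMl//.
    apply: (le_trans (rle (s *: y) (s * u) _ _)); [exact: DZ|exact: mulr_ge0 (ltW s0) u0|].
    rewrite -scalerA -scalerDr qZ ?(ltW s0)//; last by apply: DD => //; exact: DZ.
    by rewrite mulrBr mulrA.
  apply/eqP; rewrite eq_le rle'//=.
  have [->|tn0] := eqVneq t 0.
    rewrite scale0r mul0r; apply: (le_trans _ (lb_le_inf (Sinf _ D0).1 (Slb _ D0))).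
    by rewrite oppr0 (sublinear0 qs) oppr0.
  have tp : 0 < t by rewrite lt_def tn0.
  rewrite -ler_pdivlMl// -{1}(scale1r x) -(mulVf tn0) -scalerA.
  by apply: rle'; [rewrite invr_ge0 ltW|exact: DZ].
- by move=> g Dg; apply: (le_trans (rle g 0 Dg _)); rewrite // scale0r addr0 mul0r subr0.
- by move=> g Dg; apply: (le_trans (rle g 1 Dg _)); rewrite // scale1r mul1r.
Qed.

(* Zorn's lemma; by sublinear_shift a minimal sublinear functional is linear. *)
Lemma minimal_sublinear p : sublinear p -> exists q, [/\ sublinear q,
  forall g, D g -> q g <= p g &
  forall r, sublinear r -> (forall g, D g -> r g <= q g) ->
    forall g, D g -> q g <= r g].
Proof.
move=> ps.
pose T := {q : V -> R | sublinear q /\ (forall g, D g -> q g <= p g)}.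
have t0 : T by exists p; split.
(* The order is reversed, so that a maximal element is a pointwise minimal functional. *)
pose rel (q r : T) : bool := `[< forall g, D g -> sval r g <= sval q g >].
have rel_refl t : rel t t by apply/asboolP.
have [||[q [qs qp]] qmax] := @ZL_preorder T t0 rel rel_refl.
- move=> r s t /asboolP rs /asboolP st; apply/asboolP => g Dg.
  exact: le_trans (st g Dg) (rs g Dg).
- move=> C totC.
  have [->|/set0P[c0 Cc0]] := eqVneq C set0; first by exists t0.
  (* A chain is bounded by its pointwise infimum, which is finite because [- p (- g)] bounds every
     member from below at g. *)
  pose S g := [set sval c g | c in C].
  have Slb g : D g -> lbound (S g) (- p (- g)).
    move=> Dg _ [[c [cs cp]] _ <-] /=; apply: (le_trans _ (sublinear_geN cs Dg)).
    by rewrite lerN2; apply: cp; exact: DN.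
  have Sinf g : D g -> has_inf (S g).
    move=> Dg; split; last by exists (- p (- g)); exact: Slb.
    by exists (sval c0 g), c0.
  pose r g := inf (S g).
  have rle g c : D g -> C c -> r g <= sval c g.
    by move=> Dg Cc; apply: ge_inf; [exact: (Sinf _ Dg).2 | exists c].
  have rs : sublinear r.
    split.
    + move=> x y Dx Dy; rewrite -lerBlDr; apply: lb_le_inf; first exact: (Sinf x Dx).1.
      move=> _ [c Cc <-]; rewrite lerBlDr -lerBlDl.
      apply: lb_le_inf; first exact: (Sinf y Dy).1.
      move=> _ [d Cd <-]; rewrite lerBlDl.
      (* Subadditivity of the infimum needs a single functional below both c and d; totality of the
         chain provides it. *)
      have [e [Ce ec ed]] : exists e, [/\ C e, sval e x <= sval c x & sval e y <= sval d y].
        by have [/asboolP cd|/asboolP dc] := totC _ _ Cc Cd; [exists d|exists c]; split; auto.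
      apply: (le_trans (rle _ e (DD Dx Dy) Ce)).
      by apply: (le_trans ((svalP e).1.1 x y Dx Dy)); exact: lerD.
    + move=> t x t0' Dx; rewrite /r.
      have -> : S (t *: x) = [set t * y | y in S x].
        apply/seteqP; split => y [].
          by move=> c Cc <-; exists (sval c x); [exists c|rewrite (svalP c).1.2].
        by move=> _ [c Cc <-] <-; exists c => //; rewrite (svalP c).1.2.
      have [->|tn0] := eqVneq t 0.
        have -> : [set 0 * y | y in S x] = [set 0]; last by rewrite inf1 mul0r.
        apply/seteqP; split => [_ [y _ <-]|_ ->]; first by rewrite mul0r.
        by exists (sval c0 x); [exists c0|rewrite mul0r].
      have tp : 0 < t by rewrite lt_def tn0.
      apply/eqP; rewrite eq_le; apply/andP; split.
        rewrite -ler_pdivrMl//; apply: lb_le_inf; first exact: (Sinf x Dx).1.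
        move=> y Sy; rewrite ler_pdivrMl//; apply: ge_inf; last by exists y.
        exists (t * - p (- x)) => _ [z Sz <-]; rewrite ler_pM2l//; exact: Slb.
      apply: lb_le_inf; first by exists (t * sval c0 x), (sval c0 x) => //; exists c0.
      move=> _ [y Sy <-]; rewrite ler_pM2l//; apply: ge_inf => //; exact: (Sinf x Dx).2.
  have rp g : D g -> r g <= p g.
    by move=> Dg; apply: (le_trans (rle _ c0 Dg Cc0)); exact: (svalP c0).2.
  exists (exist _ r (conj rs rp)) => c Cc; apply/asboolP => g Dg; exact: rle.
- exists q; split => // r rs rq g Dg.
  have rp : forall g, D g -> r g <= p g by move=> h Dh; exact: le_trans (rq h Dh) (qp h Dh).
  have /asboolP : rel (exist _ r (conj rs rp)) (exist _ q (conj qs qp)).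
    by apply: qmax; apply/asboolP.
  exact.
Qed.

(** A minimal functional below the shift p' of p by g0 is linear, by a second shift. Being below p',
    it is at most - p g0 at - g0, which gives equality at g0. *)
Lemma hahn_banach_dominated p g0 : sublinear p -> D g0 -> exists L : V -> R,
  [/\ forall g, D g -> L g <= p g, L g0 = p g0,
      forall f g, D f -> D g -> L (f + g) = L f + L g &
      forall (t : R) g, D g -> L (t *: g) = t * L g].
Proof.
move=> ps Dg0; have [p' [p's p'p p'g0]] := sublinear_shift ps Dg0.
have [q [qs qp' qmin]] := minimal_sublinear p's.
have qD f g : D f -> D g -> q (f + g) = q f + q g.
  move=> Df Dg; apply/eqP; rewrite eq_le qs.1//=.
  have [r [rs rq rf]] := sublinear_shift qs Df.
  by have := le_trans (qmin r rs rq g Dg) (rf g Dg); rewrite lerBrDl (addrC f).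
have qN g : D g -> q (- g) = - q g.
  by move=> Dg; apply/eqP; rewrite -addr_eq0 -qD ?addNr ?(sublinear0 qs)//; exact: DN.
exists q; split => //.
- by move=> g Dg; exact: le_trans (qp' g Dg) (p'p g Dg).
- apply/eqP; rewrite eq_le (le_trans (qp' _ Dg0) (p'p _ Dg0))/=.
  rewrite -lerN2 -qN// (le_trans (qp' _ (DN Dg0)))//.
  by apply: (le_trans (p'g0 _ (DN Dg0))); rewrite addNr (sublinear0 ps) sub0r.
- move=> t g Dg; have [t0|t0] := leP 0 t; first exact: qs.2.
  rewrite -[t]opprK scaleNr qN; last exact: DZ.
  by rewrite qs.2 ?mulNr// oppr_ge0 ltW.
Qed.

End HahnBanach.

(** * Finitely additive charges carried by a compact set, and their extension to Borel measures *)

Record radon_charge (R : realType) (X : ptopologicalType) := RadonCharge {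
  rc_fun :> set X -> R;
  rc_ge0 : forall A, 0 <= rc_fun A;
  rc_additive : forall A B, A `&` B = set0 ->
    rc_fun (A `|` B) = rc_fun A + rc_fun B;
  rc_hausdorff : hausdorff_space X;
  rc_support : set X;
  rc_compact : compact rc_support;
  rc_out : rc_fun (~` rc_support) = 0 }.

(** An analogue of Jordan measurability. On these sets, which form an algebra, finite additivity
    improves to countable additivity. *)
Definition approximable (R : realType) (X : ptopologicalType) (l : set X -> R)
    (A : set X) :=
  forall e, 0 < e -> exists F U,
    [/\ compact F, open U, F `<=` A, A `<=` U & l U <= l F + e].

Section RadonCharge.
Context (R : realType) (X : ptopologicalType) (l : radon_charge R X).
Implicit Types A B : set X.

Lemma rc0 : l set0 = 0.
Proof.
have := rc_additive l (setI0 set0); rewrite setU0 => /eqP.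
by rewrite -subr_eq0 opprD addrA subrr sub0r oppr_eq0 => /eqP.
Qed.

Lemma rcDI A B : l A = l (A `&` B) + l (A `\` B).
Proof.
rewrite -rc_additive ?setUIDK// setDE setIACA setICr ?setI0//.
Qed.

Lemma le_rc A B : A `<=` B -> l A <= l B.
Proof. by move=> AB; rewrite (rcDI B A) setIidr// lerDl rc_ge0. Qed.

Lemma rcU_le A B : l (A `|` B) <= l A + l B.
Proof.
rewrite (rcDI _ A); apply: lerD; apply: le_rc; first exact: subIsetr.
by move=> x [[]].
Qed.

Lemma rc_bigsetU_le (F : nat -> set X) n :
  l (\big[setU/set0]_(i < n) F i) <= \sum_(i < n) l (F i).
Proof.
elim: n => [|n IH]; first by rewrite !big_ord0 rc0.
by rewrite !big_ord_recr/=; apply: (le_trans (rcU_le _ _)); rewrite lerD2r.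
Qed.

Lemma approximableT : approximable l setT.
Proof.
move=> e e0; exists (rc_support l), setT; split => //; [exact: rc_compact|exact: openT|].
have := rcDI setT (rc_support l); rewrite setTI setTD rc_out addr0 => ->.
by rewrite lerDl ltW.
Qed.

(** Compact minus open is compact, and open minus compact is open by the Hausdorff property; the new
    gap lies in the union of the two old ones. *)
Lemma approximableD A B : approximable l A -> approximable l B ->
  approximable l (A `\` B).
Proof.
move=> hA hB e e0; have e2 : 0 < e / 2 by lra.
have [F [U [cF oU FA AU lUF]]] := hA _ e2.
have [G [V [cG oV GB BV lVG]]] := hB _ e2.
exists (F `\` V), (U `\` G); split.
- rewrite setDE; apply: compact_closedI => //; exact: open_closedC.
- rewrite setDE; apply: openI => //; apply: closed_openC.
  exact: compact_closed (rc_hausdorff l) cG.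
- by move=> x [Fx nVx]; split; [exact: FA|move=> /BV].
- by move=> x [Ax nBx]; split; [exact: AU|move=> /GB].
have lUDF : l (U `\` F) <= e / 2.
  by move: lUF; rewrite (rcDI U F) setIidr ?lerD2l//; exact: subset_trans FA AU.
have lVDG : l (V `\` G) <= e / 2.
  by move: lVG; rewrite (rcDI V G) setIidr ?lerD2l//; exact: subset_trans GB BV.
have sub : U `\` G `<=` (F `\` V) `|` ((U `\` F) `|` (V `\` G)).
  move=> x [Ux nGx]; have [Fx|nFx] := pselect (F x); last by right; left.
  by have [Vx|nVx] := pselect (V x); [right; right|left].
have := le_trans (le_rc sub) (rcU_le _ _).
have := rcU_le (U `\` F) (V `\` G).
lra.
Qed.

Lemma approximable0 : approximable l set0.
Proof. by rewrite -(setDv setT); apply: approximableD; exact: approximableT. Qed.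

Lemma approximableI A B : approximable l A -> approximable l B ->
  approximable l (A `&` B).
Proof. by move=> hA hB; rewrite -setDD; do 2 apply: approximableD => //. Qed.

Lemma approximableC A : approximable l A -> approximable l (~` A).
Proof. by move=> hA; rewrite -setTD; apply: approximableD => //; exact: approximableT. Qed.

(* A finite cover of the compact inner approximation by the open outer
   approximations turns finite into countable subadditivity. *)
Lemma rc_sigma_subadditive A (F : nat -> set X) :
  approximable l A -> (forall n, approximable l (F n)) ->
  A `<=` \bigcup_n F n -> ((l A)%:E <= \sum_(n <oo) (l (F n))%:E)%E.
Proof.
move=> hA hF AF; apply/lee_addgt0Pr => e e0.
have e2 : 0 < e / 2 by lra.
have [K [V [cK _ KA AV lAK]]] := hA _ e2.
have en n : 0 < (e / 2) / (2 ^ n.+1)%:R by rewrite divr_gt0// ltr0n expn_gt0.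
have /choice[U hU] : forall n, exists U, [/\ open U, F n `<=` U &
    l U <= l (F n) + (e / 2) / (2 ^ n.+1)%:R].
  move=> n; have [G [U [cG oU GF FU lU]]] := hF n _ (en n).
  by exists U; split => //; apply: (le_trans lU); rewrite lerD2r; exact: le_rc.
move: cK; rewrite compact_cover => /(_ _ setT U).
case=> [n _|x Kx|D _ KD]; first by have [] := hU n.
  by have [n _ Fx] := AF _ (KA _ Kx); exists n => //; have [_ + _] := hU n; exact.
pose N := (\max_(i <- D) i).+1.
have KN : K `<=` \big[setU/set0]_(i < N) U i.
  move=> x /KD[n /= nD Ux]; rewrite -bigcup_mkord; exists n => //=.
  by rewrite /N ltnS; exact: (leq_bigmax_seq (F := fun i => i)).
have : l A <= \sum_(i < N) (l (F i) + (e / 2) / (2 ^ i.+1)%:R) + e / 2.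
  rewrite (le_trans (le_rc AV))// (le_trans lAK)// lerD2r (le_trans (le_rc KN))//.
  rewrite (le_trans (rc_bigsetU_le _ _))//; apply: ler_sum => i _.
  by have [] := hU i.
rewrite -lee_fin => /le_trans; apply; rewrite EFinD.
have -> : e%:E = ((e / 2)%:E + (e / 2)%:E)%E by rewrite -EFinD; congr EFin; lra.
rewrite addeA leeD2r//.
apply: le_trans (epsilon_trick _ _ _); [|by move=> n; rewrite lee_fin rc_ge0|exact: ltW].
rewrite -sumEFin -(big_mkord xpredT (fun i => (l (F i) + e / 2 / (2 ^ i.+1)%:R)%:E)).
apply: le_trans (nneseries_lim_ge N _) => //.
by move=> n _ _; rewrite adde_ge0// lee_fin ?rc_ge0// ltW.
Qed.

(** A copy of X labelled by the charge: the semiring of sets depends on the charge, so it cannot be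
    attached to X itself. *)
Definition approximable_type of (set X -> R) : Type := X.
Definition approximable_sets := approximable_type l.
HB.instance Definition _ := Pointed.on approximable_sets.
HB.instance Definition _ := @isSemiRingOfSets.Build default_measure_display
  approximable_sets (approximable l) approximable0 approximableI
  (setD_semi_setD_closed approximableD).

Definition rc_content (A : set approximable_sets) : \bar R := (l A)%:E.

Let rc_content_ge0 A : (0 <= rc_content A)%E.
Proof. by rewrite lee_fin rc_ge0. Qed.

Let rc_content_additive : measure_function.semi_additive rc_content.
Proof.
move=> F n _ tF _; elim: n => [|n IH]; first by rewrite !big_ord0 /rc_content rc0.
rewrite !big_ord_recr/= -IH /rc_content rc_additive//.
by rewrite -bigcup_mkord setI_bigcupl bigcup0// => i /= ltin;
  have /trivIsetP/(_ i n I I) := tF; apply; rewrite ltn_eqF.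
Qed.

HB.instance Definition _ := isContent.Build _ _ _ rc_content
  rc_content_ge0 rc_content_additive.

Let rc_content_subadditive : measurable_subset_sigma_subadditive rc_content.
Proof. by move=> A F mF mA; exact: rc_sigma_subadditive. Qed.

HB.instance Definition _ := Content_SigmaSubAdditive_isMeasure.Build _ _ _
  rc_content rc_content_subadditive.

(** Caratheodory's theorem gives a measure on the sigma-algebra generated by the approximable sets;
    it contains the Borel sets by hypothesis, and the measure is repackaged on [borel X]. *)
Lemma radon_charge_extension : l setT = 1 ->
  @open X `<=` <<s approximable l >> ->
  exists g : probability (borel X) R, forall A,
    approximable l A -> measurable (A : set (borel X)) ->
    g A = (l A)%:E.
Proof.
move=> l1 sub.
have sub' : @measurable _ (borel X) `<=` <<s approximable l >>.
  exact: smallest_sub (smallest_sigma_algebra _ _) sub.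
pose g (A : set (borel X)) : \bar R := measure_extension rc_content A.
have g0 : g set0 = 0%E by exact: measure0.
have gge0 A : (0 <= g A)%E by exact: measure_ge0.
have gadd : semi_sigma_additive g.
  move=> F mF tF mUF.
  apply: (@measure_semi_sigma_additive _ _ _ (measure_extension rc_content)) => //.
    by move=> i; exact: sub'.
  exact: sub'.
have gE A : approximable l A -> g A = (l A)%:E.
  by move=> hA; rewrite /g /measure_extension measurable_mu_extE.
pose gm := HB.pack_for (measure (borel X) R) g
  (isMeasure.Build _ _ _ g g0 gge0 gadd).
have gT : gm setT = 1%E by rewrite /= gE ?l1//; exact: approximableT.
pose gp := HB.pack_for (probability (borel X) R) (Measure.sort gm)
  (Measure_isProbability.Build _ _ _ (Measure.sort gm) gT).
by exists gp => A hA _; exact: gE.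
Qed.

End RadonCharge.

(** * Borel measures on manifolds *)

(** The consequence of metrizability on which regularity of Borel measures rests. *)
Definition open_Fsigma (X : topologicalType) := forall U : set X, open U ->
  exists2 F : nat -> set X, forall n, closed (F n) & U = \bigcup_n F n.

Lemma open_borel (X : ptopologicalType) (U : set X) :
  open U -> measurable (U : set (borel X)).
Proof. by move=> oU; exact: sub_sigma_algebra. Qed.

Lemma closed_borel (X : ptopologicalType) (U : set X) :
  closed U -> measurable (U : set (borel X)).
Proof. by move=> /closed_openC/open_borel/measurableC; rewrite setCK. Qed.

Section Regularity.
Context (R : realType) (X : ptopologicalType) (mu : probability (borel X) R).

Lemma bigcup_finite_approx (F : nat -> set (borel X)) (e : R) :
  (forall n, measurable (F n)) -> 0 < e ->
  exists n, (mu (\bigcup_k F k `\` \big[setU/set0]_(k < n) F k) <= e%:E)%E.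
Proof.
move=> mF e0; apply: contrapT => /forallNP H.
pose G n := \bigcup_k F k `\` \big[setU/set0]_(k < n) F k.
have mG n : measurable (G n).
  by apply: measurableD; [exact: bigcup_measurable | exact: bigsetU_measurable].
have G0 : \bigcap_n G n = set0.
  rewrite -subset0 => x Gx; case: (Gx 0%N I) => -[k _ Fkx] _.
  case: (Gx k.+1 I) => _ nF.
  by apply: nF; rewrite -bigcup_mkord; exists k => /=.
have niG : nonincreasing_seq G.
  move=> m n mn; apply/subsetPset; apply: setDS.
  rewrite -!bigcup_mkord => x [k /= km Fx]; exists k => //=; exact: leq_trans mn.
have cv : mu \o G @ \oo --> mu (\bigcap_n G n).
  apply: nonincreasing_cvg_mu => //; last by rewrite G0.
  by rewrite (le_lt_trans (probability_le1 _ _))// ltry.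
rewrite G0 measure0 in cv.
have : (e%:E <= lim (mu \o G @ \oo))%E.
  apply: lime_ge; first by apply/cvg_ex; exists 0%E.
  by apply: nearW => n; rewrite ltW// ltNge; apply/negP; exact: H.
by move/cvg_lim : cv => -> //; rewrite lee_fin leNgt e0.
Qed.

Definition regular (A : set X) := forall e : R, 0 < e -> exists F U,
  [/\ closed F, open U, F `<=` A, A `<=` U & (mu (U `\` F) <= e%:E)%E].

Lemma open_regular (U : set X) : @open_Fsigma X -> open U -> regular U.
Proof.
move=> XF oU e e0; have [F cF UE] := XF _ oU.
have mF n : measurable (F n : set (borel X)) by exact: closed_borel.
have [n hn] := bigcup_finite_approx mF e0.
exists (\big[setU/set0]_(k < n) F k), U; split => //.
- by apply: closed_bigsetU.
- by rewrite UE -bigcup_mkord; apply: bigcup_sub => k _; exact: bigcup_sup.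
- by rewrite UE.
Qed.

(** Regular sets include the open sets and form a sigma-algebra. *)
Lemma borel_regular (A : set (borel X)) : @open_Fsigma X -> measurable A -> regular A.
Proof.
move=> XF; apply: smallest_sub; last by move=> U; exact: open_regular.
split.
- by move=> e e0; exists set0, set0; split => //; rewrite ?setD0 ?measure0 ?lee_fin ?ltW//;
    [exact: closed0|exact: open0].
- move=> B rB e e0; have [F [U [cF oU FB BU UF]]] := rB _ e0.
  exists (~` U), (~` F); split.
  + exact: open_closedC.
  + exact: closed_openC.
  + by rewrite setTD; exact: subsetC.
  + by rewrite setTD; exact: subsetC.
  + by rewrite setDE setCK setIC -setDE.
- move=> B rB e e0.
  (* Half of e pays for the gaps of the single sets, half for truncating the inner union, since only
     finite unions of closed sets are sure to be closed. *)
  have e2 : 0 < e / 2 by lra.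
  have en n : 0 < (e / 2) / (2 ^ n.+1)%:R by rewrite divr_gt0// ltr0n expn_gt0.
  have /choice[FU hFU] : forall n, exists FU : set X * set X, [/\ closed FU.1, open FU.2,
     FU.1 `<=` B n, B n `<=` FU.2 & (mu (FU.2 `\` FU.1) <= ((e / 2) / (2 ^ n.+1)%:R)%:E)%E].
    by move=> n; have [F [U ?]] := rB n _ (en n); exists (F, U).
  pose F n := (FU n).1; pose U n := (FU n).2.
  have cF n : closed (F n) by have [] := hFU n.
  have oU n : open (U n) by have [] := hFU n.
  have mF n : measurable (F n : set (borel X)) by exact: closed_borel.
  have mU n : measurable (U n : set (borel X)) by exact: open_borel.
  have [n hn] := bigcup_finite_approx mF e2.
  exists (\big[setU/set0]_(k < n) F k), (\bigcup_k U k); split => //.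
  + exact: closed_bigsetU.
  + exact: bigcup_open.
  + rewrite -bigcup_mkord => x [k _ Fx]; exists k => //; have [_ _ + _ _] := hFU k; exact.
  + by move=> x [k _ Fx]; exists k => //; have [_ _ _ + _] := hFU k; exact.
  + have sub : \bigcup_k U k `\` \big[setU/set0]_(k < n) F k `<=`
       \bigcup_k (U k `\` F k) `|` (\bigcup_k F k `\` \big[setU/set0]_(k < n) F k).
      move=> x [[k _ Ux] nF]; have [Fx|nFx] := pselect (F k x); last by left; exists k.
      by right; split => //; exists k.
    have mUF : measurable (\bigcup_k (U k `\` F k) : set (borel X)).
      by apply: bigcup_measurable => k _; exact: measurableD.
    have mFF : measurable (\bigcup_k F k `\` \big[setU/set0]_(k < n) F k : set (borel X)).
      by apply: measurableD; [exact: bigcup_measurable | exact: bigsetU_measurable].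
    apply: (@le_trans _ _ (mu (\bigcup_k (U k `\` F k)) +
      mu (\bigcup_k F k `\` \big[setU/set0]_(k < n) F k))%E).
      apply: le_trans (measureU2 _ _ _) => //; apply: le_measure => //; apply/mem_set.
        by apply: measurableD; [exact: bigcup_measurable | exact: bigsetU_measurable].
      exact: measurableU.
    rewrite (_ : e%:E = ((e / 2)%:E + (e / 2)%:E)%E); last by rewrite -EFinD; congr EFin; lra.
    apply: leeD => //.
    apply: le_trans (epsilon_trick0 xpredT (ltW e2)).
    apply: (@le_trans _ _ (\sum_(k <oo) mu (U k `\` F k))%E).
      by apply: measure_sigma_subadditive => // k; exact: measurableD.
    apply: lee_nneseries => [k _ _|k _]; first exact: measure_ge0.
    by have [] := hFU k.
Qed.

End Regularity.
Lemma continuous_measurable_borel (X Y : ptopologicalType) (f : X -> Y) :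
  continuous f -> measurable_fun setT (f : borel X -> borel Y).
Proof.
move=> cf; apply: (@measurability _ _ (borel X) (borel Y) setT f (@open Y)) => //.
move=> _ [B oB <-]; rewrite setTI; apply: open_borel.
by move/continuousP : cf; exact.
Qed.

Lemma continuous_measurable_real (R : realType) (X : ptopologicalType) (f : X -> R) :
  continuous f -> measurable_fun setT (f : borel X -> R).
Proof.
move=> cf; apply: (measurability (@RGenOpens.G R) (@RGenOpens.measurableE R)).
move=> _ [B [a [b ->]] <-]; rewrite setTI; apply: open_borel.
by move/continuousP : cf; apply; exact: interval_open.
Qed.

(** * Second countable spaces, finite products and manifolds *)

Section SecondCountable.
Context (X : topologicalType).
Hypothesis X2 : @second_countable X.

Lemma second_countable_seq : exists b : nat -> set X,
  (forall n, open (b n)) /\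
  forall x U, nbhs x U -> exists2 n, b n x & b n `<=` U.
Proof.
have [B /countable_injP[f finj] [Bo Bb]] := X2.
pose P n := fun V => B V /\ f V = n.
(* [P n] has at most one element because f is injective on the base; integers outside the range of f
   get the empty set, which is still open. *)
exists (fun n => xget set0 (P n)); split.
  by move=> n; case: xgetP => [V _ [/Bo]//|_]; exact: open0.
move=> x U /Bb[V [BV Vx] VU]; exists (f V).
all: case: xgetP => [W _ [BW fW]|/(_ V) []//].
all: by rewrite (finj W V (mem_set BW) (mem_set BV) fW).
Qed.

(** U is the union of the closures of those basic sets whose closure it contains. *)
Lemma open_Fsigma_local :
  (forall (x : X) U, open U -> U x ->
     exists C, [/\ closed C, nbhs x C & C `<=` U]) -> open_Fsigma X.
Proof.
move=> loc U oU; have [b [bo bb]] := second_countable_seq.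
exists (fun n => if pselect (closure (b n) `<=` U) then closure (b n) else set0).
  by move=> n; case: pselect => cl; [exact: closed_closure|exact: closed0].
apply/seteqP; split => x; last first.
  by move=> [n nT]; case: pselect => [cl /cl|].
move=> Ux; have [C [cC nC CU]] := loc x U oU Ux.
have [n bnx bnC] := bb x C nC; exists n => //.
have cbC : closure (b n) `<=` C.
  by rewrite ((closure_id C).1 cC); exact: closure_subset.
have cbU : closure (b n) `<=` U by exact: subset_trans CU.
by case: (pselect (closure (b n) `<=` U)) => // cl; exact: subset_closure.
Qed.

End SecondCountable.

(** The filter generated by all boxes around x is finer than the neighbourhood filter; this is
    checked on one factor at a time. *)
Lemma nbhs_prod_box (I : eqType) (T : I -> topologicalType) (x : prod_topology T)
    (U : set (prod_topology T)) : nbhs x U ->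
  exists2 V : forall i, set (T i), forall i, nbhs (x i) (V i) &
    [set y | forall i, V i (y i)] `<=` U.
Proof.
pose F := filter_from [set V : forall i, set (T i) | forall i, nbhs (x i) (V i)]
  (fun V => [set y : prod_topology T | forall i, V i (y i)]).
have FF : ProperFilter F.
  apply: filter_from_proper; last first.
    by move=> V xV; exists x => i; exact: nbhs_singleton (xV i).
  apply: filter_from_filter; first by exists (fun=> setT) => i; exact: filterT.
  move=> V W xV xW; exists (fun i => V i `&` W i) => [i|y VWy]; first exact: filterI.
  by split => i; have [] := VWy i.
have Fx : F --> x.
  apply/cvg_sup => i N [V [[W oW <-] Wx WN]].
  apply: (filterS WN).
  exists (fun j => [set z | forall e : j = i, W (ecast k (T k) e z)]).
    move=> j; have [ji|ji] := eqVneq j i; last first.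
      by apply: nearW => z e; rewrite e eqxx in ji.
    subst j; have : nbhs (x i) W by apply: open_nbhs_nbhs.
    by apply: filterS => z Wz e; rewrite (eq_irrelevance e erefl).
  by move=> y /(_ i erefl).
by move=> /Fx [V xV VU]; exists V.
Qed.

Section Manifold.
Context (R : realType) (M : smoothManifold R).

Lemma chart_dom_open_nbhs (e : chart R (manifold_dim M) M) x :
  chart_dom e x -> nbhs x (chart_dom e).
Proof. by move=> ex; apply: open_nbhs_nbhs; split => //; exact: chart_dom_open. Qed.

Lemma chart_map_cod (e : chart R (manifold_dim M) M) x :
  chart_dom e x -> chart_cod e (e x).
Proof. by exists x. Qed.

Lemma chart_mapE (e : chart R (manifold_dim M) M) x :
  chart_dom e x -> chart_inv e (e x) = x.
Proof. by move=> ex; exact: (chart_mapK (mem_set ex)). Qed.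

Lemma chart_inv_nbhs (e : chart R (manifold_dim M) M) p U :
  chart_cod e p -> nbhs (chart_inv e p) U -> nbhs p (chart_inv e @^-1` U).
Proof. by move=> ep; exact: (chart_inv_continuous (c := e) (mem_set ep)). Qed.

Lemma chart_map_nbhs (e : chart R (manifold_dim M) M) x U :
  chart_dom e x -> nbhs (e x) U -> nbhs x (e @^-1` U).
Proof. by move=> ex; exact: (chart_map_continuous (c := e) (mem_set ex)). Qed.

(** Images of closed balls under inverse charts are compact, hence closed, and form small closed
    neighbourhoods. *)
Lemma manifold_Fsigma : open_Fsigma M.
Proof.
apply: open_Fsigma_local; first exact: manifold_second_countable.
move=> x U oU Ux; have [e _ ex] := atlas_cover x.
have nU : nbhs (e x) (chart_cod e `&` chart_inv e @^-1` U).
  apply: filterI.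
    by apply: open_nbhs_nbhs; split; [exact: chart_cod_open|exact: chart_map_cod].
  apply: chart_inv_nbhs; first exact: chart_map_cod.
  by rewrite chart_mapE//; apply: open_nbhs_nbhs.
have [r rU] := (nbhs_closedballP _ _).1 nU.
pose C := chart_inv e @` closed_ball (e x) r%:num.
exists C; split.
- apply: compact_closed; first exact: manifold_hausdorff.
  apply: continuous_compact.
    apply: continuous_in_subspaceT => p /set_mem/rU[pc _].
    exact: (chart_inv_continuous (c := e) (mem_set pc)).
  apply: bounded_closed_compact; last exact: closed_ball_closed.
  rewrite closed_ballE//; exists (`|e x| + r%:num); split; first exact: num_real.
  move=> s hs p /= hp; apply: ltW; apply: le_lt_trans hs.
  rewrite -[p](subrK (e x)) addrC; apply: (le_trans (ler_normD _ _)).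
  by rewrite lerD2l distrC.
- have : nbhs x (chart_dom e `&` e @^-1` (ball (e x) r%:num)).
    apply: filterI; first exact: chart_dom_open_nbhs.
    by apply: chart_map_nbhs => //; exact: nbhsx_ballx.
  apply: filterS => y [ey yb]; exists (e y); last by rewrite chart_mapE.
  exact: subset_closure.
- by move=> _ [p /rU[_ Up] <-].
Qed.

Lemma msupport_closed (X : ptopologicalType) (mu : probability (borel X) R) :
  closed (msupport mu).
Proof.
move=> x clx U Ux; have [y [sy Uy]] := clx U (open_nbhs_nbhs Ux).
by apply: sy; split => //; exact: Ux.1.
Qed.

(** The complement of the support is covered by the basic open sets of measure 0, which are
    countably many. *)
Lemma msupport_full (X : ptopologicalType) (mu : probability (borel X) R) :
  @second_countable X -> mu (~` msupport mu) = 0%E.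
Proof.
move=> X2; have [b [bo bb]] := second_countable_seq X2.
pose F n : set (borel X) := if mu (b n) == 0%E then b n else set0.
have mF n : measurable (F n).
  by rewrite /F; case: ifP => // _; apply: open_borel; exact: bo.
have FE : ~` msupport mu `<=` \bigcup_n F n.
  move=> x /existsNP[U /not_implyP[[oU Ux] /negP]]; rewrite -leNgt => U0.
  have [n bnx bnU] := bb x U (open_nbhs_nbhs (conj oU Ux)).
  exists n => //; rewrite /F ifT// -measure_le0 (le_trans _ U0)//.
  by apply: le_measure => //; apply/mem_set; exact: open_borel.
have : (mu (\bigcup_n F n) <= 0)%E.
  apply: le_trans (measure_sigma_subadditive _ _ _ _) _ => //.
    exact: bigcup_measurable.
  rewrite eseries0// => n _ _; rewrite /F; case: ifPn => [/eqP//|_].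
  by rewrite measure0.
rewrite measure_le0 => /eqP U0; apply/eqP; rewrite -measure_le0 -U0.
apply: le_measure => //; apply/mem_set; last exact: bigcup_measurable.
by apply: open_borel; apply: closed_openC; exact: msupport_closed.
Qed.

End Manifold.

(** * Integrals of functions bounded on a set of full measure *)

Section Mean.
Context d (T : measurableType d) (R : realType) (P : probability T R) (K : set T).
Hypotheses (mK : measurable K) (PK : P (~` K) = 0%E).

(** Bounded on K only, although measurable everywhere: potentials are controlled on the supports and
    not beyond. *)
Definition bounded_measurable (u : T -> R) :=
  measurable_fun setT u /\ exists B : R, forall x, K x -> `|u x| <= B.

Definition mean (u : T -> R) : R := \int[P]_(x in K) u x.

Lemma probability_full : P K = 1%E.
Proof.
rewrite -(@probability_setT _ _ _ P) -(setUv K) measureU ?setICr//.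
  by rewrite [X in (_ + X)%E](_ : _ = 0%E) ?adde0//; exact: PK.
exact: measurableC.
Qed.

Lemma bounded_measurable_integrable u : bounded_measurable u ->
  P.-integrable K (EFin \o u).
Proof.
move=> [mu [B uB]]; apply: measurable_bounded_integrable => //.
- by rewrite (le_lt_trans (probability_le1 _ _))// ltry.
- exact: measurable_funTS.
- exists B; split; first exact: num_real.
  by move=> x Bx y Ky /=; apply: le_trans (uB y Ky) (ltW Bx).
Qed.

Lemma bounded_measurableD u v : bounded_measurable u -> bounded_measurable v ->
  bounded_measurable (fun x => u x + v x).
Proof.
move=> [mu [B uB]] [mv [C vC]]; split; first exact: measurable_funD.
exists (B + C) => x Kx; apply: le_trans (ler_normD _ _) _.
by apply: lerD; [exact: uB|exact: vC].
Qed.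

Lemma bounded_measurableZ t u : bounded_measurable u ->
  bounded_measurable (fun x => t * u x).
Proof.
move=> [mu [B uB]]; split; first exact: measurable_funM.
by exists (`|t| * B) => x Kx; rewrite normrM ler_wpM2l// uB.
Qed.

Lemma bounded_measurable_cst a : bounded_measurable (fun=> a).
Proof. by split; [exact: measurable_cst|exists `|a|]. Qed.

Lemma bounded_measurable_sum (I : Type) (s : seq I) (u : I -> T -> R) :
  (forall i, bounded_measurable (u i)) -> bounded_measurable (fun x => \sum_(i <- s) u i x).
Proof.
move=> hu; elim: s => [|i s IH].
  by under eq_fun do rewrite big_nil; exact: bounded_measurable_cst.
by under eq_fun do rewrite big_cons; exact: bounded_measurableD.
Qed.

Lemma meanD u v : bounded_measurable u -> bounded_measurable v ->
  mean (fun x => u x + v x) = mean u + mean v.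
Proof. by move=> hu hv; rewrite /mean RintegralD//; exact: bounded_measurable_integrable. Qed.

Lemma meanZ t u : bounded_measurable u -> mean (fun x => t * u x) = t * mean u.
Proof. by move=> hu; rewrite /mean RintegralZl//; exact: bounded_measurable_integrable. Qed.

Lemma mean_cst a : mean (fun=> a) = a.
Proof.
by rewrite /mean Rintegral_cst// [X in fine X](_ : _ = 1%E) ?mulr1//; exact: probability_full.
Qed.

Lemma mean_sum (I : Type) (s : seq I) (u : I -> T -> R) :
  (forall i, bounded_measurable (u i)) ->
  mean (fun x => \sum_(i <- s) u i x) = \sum_(i <- s) mean (u i).
Proof.
move=> hu; elim: s => [|i s IH].
  by under [in LHS]eq_fun do rewrite big_nil; rewrite big_nil mean_cst.
under [in LHS]eq_fun do rewrite big_cons; rewrite big_cons -IH meanD//.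
exact: bounded_measurable_sum.
Qed.

Lemma eq_mean u v : (forall x, K x -> u x = v x) -> mean u = mean v.
Proof. by move=> uv; apply: eq_Rintegral => x /set_mem; exact: uv. Qed.

Lemma le_mean u v : bounded_measurable u -> bounded_measurable v ->
  (forall x, K x -> u x <= v x) -> mean u <= mean v.
Proof.
by move=> hu hv uv; apply: le_Rintegral => //; exact: bounded_measurable_integrable.
Qed.

Lemma bounded_measurable_indic (A : set T) : measurable A ->
  bounded_measurable (\1_A : T -> R).
Proof.
move=> mA; split; first exact: measurable_indic.
by exists 1 => x _; rewrite indicE ger0_norm//; case: (_ \in _).
Qed.

Lemma mean_indic (A : set T) : measurable A -> mean (\1_A) = fine (P A).
Proof.
move=> mA; rewrite /mean /Rintegral integral_indic//; congr fine.
rewrite -[in RHS](setIT A) -(setUv K) setIUr measureU//.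
- rewrite [X in (_ + X)%E](_ : _ = 0%E) ?adde0//; apply/eqP; rewrite -measure_le0 -PK.
  apply: le_measure => //; apply/mem_set; last exact: measurableC.
  by apply: measurableI => //; exact: measurableC.
- exact: measurableI.
- by apply: measurableI => //; exact: measurableC.
- by rewrite setIACA setICr setI0.
Qed.

Lemma EFin_mean u : bounded_measurable u ->
  (mean u)%:E = (\int[P]_x (u x)%:E)%E.
Proof.
move=> hu; have iu := bounded_measurable_integrable hu.
rewrite /mean /Rintegral fineK; last exact: integrable_fin_num.
rewrite integral_mkcond; apply: ae_eq_integral => //.
- apply/(measurable_restrictT _ mK); apply: measurable_funTS.
  by apply/measurable_EFinP; exact: hu.1.
- by apply/measurable_EFinP; exact: hu.1.
exists (~` K); split => //; first exact: measurableC.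
by move=> x /= /not_implyP[_ h] Kx; apply: h; rewrite patchE mem_set.
Qed.

End Mean.

(** * Kantorovich duality *)

Section Plan.
Context (R : realType) (m : nat) (M : 'I_m.+1 -> smoothManifold R)
  (mu : forall i, probability (borel (M i)) R).
Hypothesis mu_compact : forall i, compactly_supported (mu i).

Definition spt i : set (borel (M i)) := msupport (mu i).
Arguments spt : clear implicits.

Definition spts : set (mprod M) := [set x | forall i, spt i (x i)].

Lemma spt_measurable i : measurable (spt i).
Proof. by apply: closed_borel; exact: msupport_closed. Qed.

Lemma spt_full i : mu i (~` spt i) = 0%E.
Proof. by apply: msupport_full; exact: manifold_second_countable. Qed.

Lemma spts_compact : compact spts.
Proof. exact: (tychonoff mu_compact). Qed.

Lemma mprod_hausdorff : hausdorff_space (mprod M).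
Proof. by apply: hausdorff_product => i; exact: manifold_hausdorff. Qed.

Lemma mprod_proj_continuous i : continuous (fun x : mprod M => x i).
Proof. exact: proj_continuous. Qed.

Definition integ i (u : borel (M i) -> R) : R := mean (mu i) (spt i) u.
Definition bmeas i (u : borel (M i) -> R) := bounded_measurable (spt i) u.

Lemma integ_cst i a : integ (i := i) (fun=> a) = a.
Proof. by apply: mean_cst; [exact: spt_measurable|exact: spt_full]. Qed.

Lemma bmeas_cst i a : bmeas (i := i) (fun=> a).
Proof. exact: bounded_measurable_cst. Qed.

Lemma integD i (u v : borel (M i) -> R) : bmeas u -> bmeas v ->
  integ (fun x => u x + v x) = integ u + integ v.
Proof. by apply: meanD; exact: spt_measurable. Qed.

Lemma integZ i t (u : borel (M i) -> R) : bmeas u ->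
  integ (fun x => t * u x) = t * integ u.
Proof. by apply: meanZ; exact: spt_measurable. Qed.

Lemma spt_le_integ i (u : borel (M i) -> R) e : bmeas u -> 0 < e ->
  exists x, spt i x /\ u x < integ u + e.
Proof.
move=> hu e0; apply: contrapT => /forallNP H.
have : integ (i := i) (fun=> integ u + e) <= integ u.
  apply: le_mean => //; [exact: spt_measurable|exact: bmeas_cst|].
  by move=> x Kx; rewrite leNgt; apply/negP => h; exact: (H x).
by rewrite integ_cst gerDl leNgt e0.
Qed.

(* No product measure is needed: take each x_i where u_i is at most its mean. *)
Lemma integ_sum_ge (u : forall i, borel (M i) -> R) a : (forall i, bmeas (u i)) ->
  (forall x, spts x -> a <= \sum_i u i (x i)) -> a <= \sum_i integ (u i).
Proof.
move=> hu ha; apply/ler_addgt0Pr => e e0.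
have em : 0 < e / m.+1%:R by rewrite divr_gt0// ltr0n.
pose x : mprod M := fun i => sval (cid (spt_le_integ (hu i) em)).
have xK : spts x by move=> i; have [] := svalP (cid (spt_le_integ (hu i) em)).
have ux i : u i (x i) <= integ (u i) + e / m.+1%:R.
  by apply: ltW; have [] := svalP (cid (spt_le_integ (hu i) em)).
apply: (le_trans (ha x xK)); apply: (le_trans (ler_sum _ (fun i _ => ux i))).
rewrite big_split/= lerD2l sumr_const card_ord -[X in X <= _]mulr_natr.
by rewrite divfK// pnatr_eq0.
Qed.

Definition majorants (f : mprod M -> R) := [set u : forall i, borel (M i) -> R |
  (forall i, bmeas (u i)) /\ forall x, spts x -> f x <= \sum_i u i (x i)].

(** An infimum over majorants, so that it is sublinear in f; the usual dual supremum for a cost c is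
    [- dual (- c)]. *)
Definition dual (f : mprod M -> R) : R :=
  inf [set \sum_i integ (u i) | u in majorants f].

Definition bounded_spts (f : mprod M -> R) :=
  exists B, forall x, spts x -> `|f x| <= B.

Lemma majorants_bounded f B : (forall x, spts x -> f x <= B) ->
  exists2 u, majorants f u & \sum_i integ (u i) = B.
Proof.
move=> fB; exists (fun i => fun=> if i == ord0 then B else 0).
  split=> [i|x Kx]; first exact: bmeas_cst.
  by rewrite -big_mkcond/= big_pred1_eq fB.
under eq_bigr do rewrite integ_cst.
by rewrite -big_mkcond/= big_pred1_eq.
Qed.

Lemma dual_lbound f B : (forall x, spts x -> B <= f x) ->
  lbound [set \sum_i integ (u i) | u in majorants f] B.
Proof.
move=> fB _ [u [hu uf] <-]; apply: integ_sum_ge => // x Kx.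
exact: le_trans (fB x Kx) (uf x Kx).
Qed.

Lemma dual_has_inf f : bounded_spts f ->
  has_inf [set \sum_i integ (u i) | u in majorants f].
Proof.
move=> [B fB]; split.
  have [x Kx|u hu uB] := @majorants_bounded f B.
    exact: le_trans (ler_norm _) (fB x Kx).
  by exists (\sum_i integ (u i)), u.
exists (- B); apply: dual_lbound => x Kx.
by rewrite lerNl (le_trans _ (fB x Kx))// -normrN ler_norm.
Qed.

Lemma dual_le f u : bounded_spts f -> majorants f u -> dual f <= \sum_i integ (u i).
Proof. by move=> /dual_has_inf[_ hf] hu; apply: ge_inf => //; exists u. Qed.

Lemma dual_le_cst f B : bounded_spts f -> (forall x, spts x -> f x <= B) -> dual f <= B.
Proof. by move=> hf /majorants_bounded[u hu <-]; exact: dual_le. Qed.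

Lemma bounded_spts_cst a : bounded_spts (fun=> a).
Proof. by exists `|a|. Qed.

Lemma bounded_sptsD f g : bounded_spts f -> bounded_spts g -> bounded_spts (f + g).
Proof.
move=> [B fB] [C gC]; exists (B + C) => x Kx; apply: le_trans (ler_normD _ _) _.
by apply: lerD; [exact: fB|exact: gC].
Qed.

Lemma bounded_sptsZ (t : R) f : bounded_spts f -> bounded_spts (t *: f).
Proof.
by move=> [B fB]; exists (`|t| * B) => x Kx; rewrite normrM ler_wpM2l// fB.
Qed.

Lemma dual_sublinear : sublinear bounded_spts dual.
Proof.
have dualZ t f : 0 < t -> bounded_spts f -> dual (t *: f) <= t * dual f.
  move=> t0 hf; rewrite -ler_pdivrMl//; apply: lb_le_inf; first exact: (dual_has_inf hf).1.
  move=> _ [u [hu uf] <-]; rewrite ler_pdivrMl// mulr_sumr.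
  rewrite -(eq_bigr _ (fun i _ => integZ t (hu i))).
  apply: dual_le; first exact: bounded_sptsZ.
  split=> [i|x Kx]; first exact: (bounded_measurableZ t (hu i)).
  by rewrite -mulr_sumr ler_pM2l//; exact: uf.
split => [f g hf hg|t f].
  rewrite -lerBlDr; apply: lb_le_inf; first exact: (dual_has_inf hf).1.
  move=> _ [u [hu uf] <-]; rewrite lerBlDr -lerBlDl.
  apply: lb_le_inf; first exact: (dual_has_inf hg).1.
  move=> _ [v [hv vg] <-]; rewrite lerBlDl -big_split/=.
  rewrite -(eq_bigr _ (fun i _ => integD (hu i) (hv i))).
  apply: dual_le; first exact: bounded_sptsD.
  split=> [i|x Kx]; first exact: (bounded_measurableD (hu i) (hv i)).
  by rewrite big_split/=; apply: lerD; [exact: uf|exact: vg].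
have [->|tn0] := eqVneq t 0 => [_ hf|t0 hf].
  rewrite scale0r mul0r; apply/eqP; rewrite eq_le dual_le_cst//=.
    by apply: lb_le_inf; [exact: (dual_has_inf (bounded_spts_cst 0)).1|exact: dual_lbound].
  exact: bounded_spts_cst.
have tp : 0 < t by rewrite lt_def tn0.
apply/eqP; rewrite eq_le dualZ//= -ler_pdivlMl//.
by rewrite -{1}(scale1r f) -(mulVf tn0) -scalerA dualZ ?invr_gt0//; exact: bounded_sptsZ.
Qed.

End Plan.

(** * The charge of a linear functional below the dual value *)

Section Functional.
Context (R : realType) (m : nat) (M : 'I_m.+1 -> smoothManifold R)
  (mu : forall i, probability (borel (M i)) R).
Hypothesis mu_compact : forall i, compactly_supported (mu i).
Context (L : (mprod M -> R) -> R).
Hypotheses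
  (L_le : forall f, bounded_spts mu f -> L f <= dual mu f)
  (LD : forall f g, bounded_spts mu f -> bounded_spts mu g -> L (f + g) = L f + L g)
  (LZ : forall (t : R) f, bounded_spts mu f -> L (t *: f) = t * L f).

Let K := spts mu.
Let bnd := bounded_spts mu.

(** [dual] of a function that is nonpositive on K is at most 0, and L lies below [dual]. *)
Lemma functional_mono f g : bnd f -> bnd g ->
  (forall x, K x -> f x <= g x) -> L f <= L g.
Proof.
move=> hf hg fg; have hNg : bnd (-1 *: g) by exact: bounded_sptsZ.
have hfg : bnd (f + -1 *: g) by exact: bounded_sptsD.
rewrite -subr_le0 -mulN1r -LZ// -LD//; apply: (le_trans (L_le hfg)).
apply: dual_le_cst => // x Kx.
by rewrite !fctE -[_ *: _]/(-1 * g x) mulN1r subr_le0 fg.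
Qed.

Lemma bounded_spts_proj i (u : borel (M i) -> R) :
  bmeas mu u -> bnd (fun x => u (x i)).
Proof. by move=> [_ [B uB]]; exists B => x Kx; apply: uB; exact: Kx. Qed.

(** The family equal to u at i and 0 elsewhere is a majorant, so L is at most the mean of u; the
    same bound for - u gives equality. Hence L has the marginals mu_i. *)
Lemma functional_proj i (u : borel (M i) -> R) :
  bmeas mu u -> L (fun x => u (x i)) = integ mu u.
Proof.
have le v : bmeas mu v -> L (fun x => v (x i)) <= integ mu v.
  move=> hv; apply: (le_trans (L_le (bounded_spts_proj hv))).
  pose w j : borel (M j) -> R := if pselect (i = j) is left e then
     ecast k (borel (M k) -> R) e v else fun=> 0.
  have wi : w i = v.
    by rewrite /w; case: pselect => // e; rewrite (eq_irrelevance e erefl).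
  have wj j : j != i -> w j = fun=> 0.
    by rewrite /w; case: pselect => // e /eqP[].
  have -> : integ mu v = \sum_j integ mu (w j).
    rewrite (bigD1 i)//= wi big1 ?addr0// => j /wj ->; exact: integ_cst.
  apply: dual_le; first exact: bounded_spts_proj.
  split=> [j|x Kx].
    have [->|/wj ->] := eqVneq j i; first by rewrite wi.
    exact: bmeas_cst.
  by rewrite (bigD1 i)//= wi big1 ?addr0// => j /wj ->.
move=> hu; apply/eqP; rewrite eq_le le//=.
have hNu : bmeas mu (fun x => -1 * u x) by exact: bounded_measurableZ.
rewrite -lerN2 -mulN1r -LZ; last exact: bounded_spts_proj.
by apply: (le_trans (le _ hNu)); rewrite integZ// mulN1r.
Qed.

Lemma functional_cst a : L (fun=> a) = a.
Proof.
have := functional_proj (bmeas_cst mu ord0 a) => /= ->; exact: integ_cst.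
Qed.

Definition charge (A : set (mprod M)) : R := L (\1_A).

Lemma bounded_spts_indic A : bnd (\1_A).
Proof. by exists 1 => x _; rewrite indicE ger0_norm//; case: (_ \in _). Qed.

Lemma indicU_disjoint (A B : set (mprod M)) : A `&` B = set0 ->
  \1_(A `|` B) = \1_A + \1_B :> (mprod M -> R).
Proof.
move=> AB; apply/funext => x; rewrite !fctE !indicE in_setU.
case: (boolP (x \in A)) => xA; case: (boolP (x \in B)) => xB //=.
- have : (A `&` B) x by split; exact: set_mem.
  by rewrite AB.
- by rewrite addr0.
- by rewrite add0r.
- by rewrite addr0.
Qed.

Lemma charge_ge0 A : 0 <= charge A.
Proof.
rewrite -[leLHS](functional_cst 0); apply: functional_mono.
- exact: bounded_spts_cst.
- exact: bounded_spts_indic.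
- by move=> x _; rewrite indicE ler0n.
Qed.

Lemma charge_additive A B : A `&` B = set0 -> charge (A `|` B) = charge A + charge B.
Proof.
by move=> AB; rewrite /charge indicU_disjoint// LD//; exact: bounded_spts_indic.
Qed.

Lemma charge_out : charge (~` K) = 0.
Proof.
apply/eqP; rewrite eq_le charge_ge0 andbT -[leRHS](functional_cst 0).
apply: functional_mono; [exact: bounded_spts_indic|exact: bounded_spts_cst|].
by move=> x Kx; rewrite indicE memNset// => /(_ Kx).
Qed.

Definition plan_charge : radon_charge R (mprod M) :=
  RadonCharge charge_ge0 charge_additive (@mprod_hausdorff _ _ _)
    (spts_compact mu_compact) charge_out.

Lemma plan_charge_proj i (A : set (borel (M i))) : measurable A ->
  plan_charge ((fun x : mprod M => x i) @^-1` A) = fine (mu i A).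
Proof.
move=> mA; rewrite -(mean_indic (@spt_measurable _ _ _ mu i) (@spt_full _ _ _ mu i) mA).
rewrite [RHS](esym (functional_proj (bounded_measurable_indic R _ mA))).
rewrite /= /charge; congr L; apply/funext => x; rewrite !indicE.
Qed.

Lemma plan_chargeT : plan_charge setT = 1.
Proof.
have := @plan_charge_proj ord0 setT measurableT; rewrite preimage_setT => ->.
by rewrite probability_setT.
Qed.

(** Regularity of mu_i provides F and U in the factor; the preimage of F becomes compact when
    intersected with K, outside which the charge vanishes. *)
Lemma approximable_proj i (A : set (borel (M i))) : measurable A ->
  approximable plan_charge ((fun x : mprod M => x i) @^-1` A).
Proof.
move=> mA e e0.
have [F [U [cF oU FA AU UF]]] := borel_regular (mu i) (@manifold_Fsigma _ (M i)) mA e0.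
have mF : measurable (F : set (borel (M i))) by exact: closed_borel.
have mU : measurable (U : set (borel (M i))) by exact: open_borel.
exists (K `&` (fun x : mprod M => x i) @^-1` F), ((fun x : mprod M => x i) @^-1` U).
split.
- apply: compact_closedI; first exact: spts_compact.
  by apply: closed_comp => // x _; exact: mprod_proj_continuous.
- by apply: open_comp => // x _; exact: mprod_proj_continuous.
- by move=> x [_ /FA].
- by move=> x /AU.
have UFE : U = F `|` (U `\` F) by rewrite setDUK//; exact: subset_trans FA AU.
have -> : plan_charge (K `&` (fun x : mprod M => x i) @^-1` F) =
    plan_charge ((fun x : mprod M => x i) @^-1` F).
  rewrite [RHS](rcDI _ _ K) setIC [X in _ = _ + X](_ : _ = 0) ?addr0//.
  apply/eqP; rewrite eq_le rc_ge0 andbT -[leRHS]charge_out.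
  by apply: le_rc => x [].
rewrite !plan_charge_proj// [in X in fine X]UFE.
rewrite measureU//; [|exact: measurableD|exact: setDIK].
have fin (B : set (borel (M i))) : measurable B -> mu i B \is a fin_num.
  move=> mB; rewrite ge0_fin_numE//; apply: le_lt_trans (probability_le1 _ _) _ => //.
  by rewrite ltry.
have mUF : measurable (U `\` F : set (borel (M i))) by exact: measurableD.
rewrite fineD ?fin// lerD2l -lee_fin fineK ?fin//.
Qed.

Lemma approximable_box (V : forall i, set (M i)) : (forall i, open (V i)) ->
  approximable plan_charge [set x : mprod M | forall i, V i (x i)].
Proof.
move=> oV; have -> : [set x : mprod M | forall i, V i (x i)] =
   \big[setI/setT]_(i < m.+1) ((fun x : mprod M => x i) @^-1` V i).
  rewrite -bigcap_seq; apply/seteqP; split => x /= Vx i; first by move=> _; exact: Vx.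
  by apply: Vx; rewrite /= mem_index_enum.
elim/big_ind : _ => [|A B hA hB|i _].
- exact: approximableT.
- exact: approximableI.
- by apply: approximable_proj; exact: open_borel.
Qed.

(** Boxes of basic open sets are indexed by finite functions into nat, so an open set is a countable
    union of such boxes. *)
Lemma open_sigma_approximable :
  @open (mprod M) `<=` <<s approximable plan_charge >>.
Proof.
move=> U oU.
have b i := cid (second_countable_seq (@manifold_second_countable _ (M i))).
pose bo i n : set (M i) := sval (b i) n.
have boo i n : open (bo i n) by exact: (svalP (b i)).1.
have bob i x V : nbhs x V -> exists2 n, bo i n x & bo i n `<=` V.
  exact: (svalP (b i)).2.
pose box (n : {ffun 'I_m.+1 -> nat}) := [set x : mprod M | forall i, bo i (n i) (x i)].
pose F n := if `[< box n `<=` U >] then box n else set0.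
have -> : U = \bigcup_n F n.
  apply/seteqP; split => x; last by move=> [n _]; rewrite /F; case: asboolP => // nU /nU.
  move=> Ux; have [V xV VU] := nbhs_prod_box (open_nbhs_nbhs (conj oU Ux)).
  pose n := [ffun i => sval (cid2 (bob i (x i) (V i) (xV i)))].
  have bn : box n `<=` U.
    move=> y yn; apply: VU => i.
    by have := yn i; rewrite /n ffunE; case: cid2 => k /= _; exact.
  exists n => //; rewrite /F asboolT// => i.
  by rewrite /n ffunE; case: cid2.
have : measurable (\bigcup_n F n : set (g_sigma_algebraType (approximable plan_charge))).
  apply: countable_bigcupT_measurable; first exact: countableP.
  move=> n; rewrite /F; case: asboolP => _; last exact: measurable0.
  have ab := @approximable_box (fun i => bo i (n i)) (fun i => boo i (n i)).
  exact: sub_sigma_algebra.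
by [].
Qed.

End Functional.

(** * The plan integrates continuous functions as the functional does *)

Section PlanIntegral.
Context (R : realType) (m : nat) (M : 'I_m.+1 -> smoothManifold R)
  (mu : forall i, probability (borel (M i)) R).
Hypothesis mu_compact : forall i, compactly_supported (mu i).
Context (L : (mprod M -> R) -> R).
Hypotheses
  (L_le : forall f, bounded_spts mu f -> L f <= dual mu f)
  (LD : forall f g, bounded_spts mu f -> bounded_spts mu g -> L (f + g) = L f + L g)
  (LZ : forall (t : R) f, bounded_spts mu f -> L (t *: f) = t * L f).

Let K : set (borel (mprod M)) := spts mu.
Let bnd := bounded_spts mu.
Let lam := plan_charge mu_compact L_le LD LZ.

Context (g : probability (borel (mprod M)) R).
Hypothesis gE : forall A, approximable lam A -> measurable (A : set (borel (mprod M))) ->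
  g A = (lam A)%:E.

Lemma spts_measurable : measurable K.
Proof.
apply: closed_borel; apply: compact_closed; first exact: mprod_hausdorff.
exact: spts_compact.
Qed.

Lemma approximable_spts : approximable lam K.
Proof.
move=> e e0; exists K, setT; split => //; [exact: spts_compact|exact: openT|].
by rewrite (rcDI lam setT K) setTI setTD (rc_out lam) addr0 lerDl ltW.
Qed.

Lemma plan_spts : g (~` K) = 0%E.
Proof.
rewrite gE; first by congr EFin; exact: (rc_out lam).
- by apply: approximableC; exact: approximable_spts.
- by apply: measurableC; exact: spts_measurable.
Qed.

Lemma bounded_measurable_bnd (u : borel (mprod M) -> R) :
  bounded_measurable K u -> bnd u.
Proof. by case. Qed.

Definition exact_fun (u : borel (mprod M) -> R) :=
  bounded_measurable K u /\ L u = mean g K u.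

Lemma exact_funD u v : exact_fun u -> exact_fun v -> exact_fun (u + v).
Proof.
move=> [hu Lu] [hv Lv]; split; first exact: bounded_measurableD.
rewrite LD; [|exact: bounded_measurable_bnd|exact: bounded_measurable_bnd].
by rewrite Lu Lv -meanD//; exact: spts_measurable.
Qed.

Lemma exact_funZ (t : R) u : exact_fun u -> exact_fun (t *: u : mprod M -> R).
Proof.
move=> [hu Lu]; split; first exact: (bounded_measurableZ t hu).
rewrite LZ; last exact: bounded_measurable_bnd.
by rewrite Lu -meanZ//; exact: spts_measurable.
Qed.

Lemma exact_fun_indic A : approximable lam A ->
  measurable (A : set (borel (mprod M))) -> exact_fun (\1_A).
Proof.
move=> aA mA; split; first exact: bounded_measurable_indic.
rewrite mean_indic//; [|exact: spts_measurable|exact: plan_spts].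
by rewrite [X in fine X](gE aA mA).
Qed.

(** The first box of the list that contains y decides, so the boxes may overlap. *)
Fixpoint step (box : mprod M -> set (mprod M)) (c : mprod M -> R) (s : seq (mprod M))
    (y : mprod M) : R :=
  if s is x :: s' then (if y \in box x then c x else step box c s' y) else 0.

(** Induction on the list, with A standing for what the boxes already treated have left over; the
    head splits A along [box x]. *)
Lemma exact_step box c s A :
  (forall x, approximable lam (box x)) ->
  (forall x, measurable (box x : set (borel (mprod M)))) ->
  approximable lam A -> measurable (A : set (borel (mprod M))) ->
  exact_fun (fun y => \1_A y * step box c s y).
Proof.
move=> ab mb; elim: s A => [|x s IH] A aA mA /=.
  rewrite (_ : (fun _ => _) = 0 *: \1_A); last first.
    by apply/funext => y; rewrite mulr0 fctE scale0r.
  by apply: exact_funZ; exact: exact_fun_indic.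
rewrite (_ : (fun _ => _) = c x *: (\1_(A `&` box x) : mprod M -> R) +
    (fun y => \1_(A `\` box x) y * step box c s y)); last first.
  apply/funext => y; rewrite !fctE !indicE in_setI in_setD -[_ *: _]/(_ * _).
  by case: (y \in A); case: (y \in box x); rewrite /= ?(mul0r, mul1r, mulr1, mulr0, addr0, add0r).
apply: exact_funD.
  by apply: exact_funZ; apply: exact_fun_indic; [exact: approximableI|exact: measurableI].
by apply: IH; [exact: approximableD|exact: measurableD].
Qed.

Lemma step_approx box c s e y :
  (forall x z, box x z -> `|c z - c x| <= e) ->
  (exists2 x, x \in s & box x y) -> `|c y - step box c s y| <= e.
Proof.
move=> hb; elim: s => [[x]//|a s IH /= [x]].
case: ifPn => [/set_mem/hb //|nay].
rewrite inE => /orP[/eqP -> bay|xs bxy]; first by rewrite mem_set in nay.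
by apply: IH; exists x.
Qed.

Lemma bounded_measurable_continuous (c : mprod M -> R) : continuous c ->
  bounded_measurable K (c : borel (mprod M) -> R).
Proof.
move=> cc; split; first exact: continuous_measurable_real.
have : compact (c @` spts mu).
  by apply: continuous_compact; [exact: continuous_subspaceT|exact: spts_compact].
move=> /compact_bounded[B [_ hB]].
exists (B + 1) => x Kx; apply: (hB (B + 1)); first by rewrite ltrDl.
by exists x.
Qed.

(** K is covered by finitely many boxes on which c stays within e of its value at the centre. L and
    g agree on the resulting step function and both are monotone, so they differ at c by at most
    2e. *)
Lemma exact_continuous (c : mprod M -> R) : continuous c -> L c = mean g K c.
Proof.
move=> cc; have [mc bc] := bounded_measurable_continuous cc.
suff H (e : R) : 0 < e -> `|L c - mean g K c| <= e *+ 2.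
  apply/eqP; rewrite -subr_eq0 -normr_le0; apply/ler_addgt0Pr => e e0.
  by rewrite add0r (le_trans (H (e / 2) _))// ?divr_gt0// mulr2n -splitr.
move=> e0.
have bx (x : mprod M) : exists V : forall i, set (M i), [/\ forall i, open (V i),
    forall i, V i (x i) & forall z, (forall i, V i (z i)) -> `|c z - c x| <= e].
  have : nbhs x (c @^-1` (ball (c x) e)) by apply: cc; exact: nbhsx_ballx.
  move=> /nbhs_prod_box[V xV VU]; exists (fun i => interior (V i)); split.
  - by move=> i; exact: open_interior.
  - by move=> i; exact: xV.
  - move=> z Vz; rewrite distrC ltW//; apply: VU => i; exact: interior_subset (Vz i).
pose V x := sval (cid (bx x)).
pose box x := [set z : mprod M | forall i, V x i (z i)].
have oV x i : open (V x i) by have [] := svalP (cid (bx x)).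
have obox x : open (box x).
  have -> : box x = \big[setI/setT]_(i < m.+1) ((fun x : mprod M => x i) @^-1` V x i).
    rewrite -bigcap_seq; apply/seteqP; split => z /= Vz i; first by move=> _; exact: Vz.
    by apply: Vz; rewrite /= mem_index_enum.
  elim/big_ind : _ => [|A B hA hB|i _]; [exact: openT|exact: openI|].
  by apply: open_comp => // z _; exact: mprod_proj_continuous.
have xbox x : box x x by move=> i; have [_ + _] := svalP (cid (bx x)); exact.
have cbox x z : box x z -> `|c z - c x| <= e by have [_ _ +] := svalP (cid (bx x)); exact.
have := spts_compact mu_compact; rewrite compact_cover.
case/(_ _ setT box) => [x _|x Kx|D _ KD]; [exact: obox|by exists x|].
pose s := enum_fset D.
have [[ms [Bs bs]] Ls] : exact_fun (fun y => \1_setT y * step box c s y).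
  apply: exact_step => [x|x||]; [exact: approximable_box|exact: open_borel| |exact: measurableT].
  exact: approximableT.
move: ms bs Ls; set st := (fun _ => _) => ms bs Ls.
have cst y : K y -> `|c y - st y| <= e.
  move=> Ky; rewrite /st indicT mul1r; apply: step_approx => //.
  by have [x xD bxy] := KD y Ky; exists x.
have hst : bounded_measurable K st by split => //; exists Bs.
have hc : bounded_measurable K (c : borel (mprod M) -> R) by split.
have hste a : bounded_measurable K (fun y => st y + a).
  by apply: bounded_measurableD => //; exact: bounded_measurable_cst.
have Lste a : L (fun y => st y + a) = mean g K (fun y => st y + a).
  have [_ La] : exact_fun (fun=> a).
    split; first exact: bounded_measurable_cst.
    rewrite mean_cst; [|exact: spts_measurable|exact: plan_spts].
    exact: (functional_cst L_le LZ).
  rewrite meanD//; [|exact: spts_measurable|exact: bounded_measurable_cst].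
  rewrite -Ls -La.
  exact: (LD (bounded_measurable_bnd hst) (bounded_spts_cst mu a)).
have mste a : mean g K (fun y => st y + a) = mean g K st + a.
  rewrite meanD//; [|exact: spts_measurable|exact: bounded_measurable_cst].
  by rewrite mean_cst; [|exact: spts_measurable|exact: plan_spts].
have cle y : K y -> st y + - e <= c y <= st y + e.
  by move=> /cst; rewrite ler_distlC lerBlDr => /andP[h1 h2]; lra.
have L1 : mean g K st + - e <= L c.
  rewrite -mste -Lste; apply: (functional_mono L_le LD LZ).
  - exact: bounded_measurable_bnd.
  - exact: bounded_measurable_bnd.
  - by move=> y /cle/andP[].
have L2 : L c <= mean g K st + e.
  rewrite -mste -Lste; apply: (functional_mono L_le LD LZ).
  - exact: bounded_measurable_bnd.
  - exact: bounded_measurable_bnd.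
  - by move=> y /cle/andP[].
have M1 : mean g K st + - e <= mean g K c.
  by rewrite -mste; apply: le_mean => //; [exact: spts_measurable|move=> y /cle/andP[]].
have M2 : mean g K c <= mean g K st + e.
  by rewrite -mste; apply: le_mean => //; [exact: spts_measurable|move=> y /cle/andP[]].
by rewrite ler_norml; apply/andP; split; lra.
Qed.

Lemma plan_coupling : coupling mu g.
Proof.
move=> i A mA; rewrite gE.
- rewrite plan_charge_proj// fineK// ge0_fin_numE//.
  by rewrite (le_lt_trans (probability_le1 _ _))// ltry.
- exact: approximable_proj.
- rewrite -[X in measurable X]setTI.
  apply: (@continuous_measurable_borel (mprod M) (M i) (fun x => x i)) => //.
  exact: mprod_proj_continuous.
Qed.

End PlanIntegral.

(** Finiteness of the index set is essential: an infinite box need not be a neighbourhood. *)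
Lemma nbhs_box (I : finType) (T : I -> topologicalType) (x : prod_topology T)
    (V : forall i, set (T i)) : (forall i, nbhs (x i) (V i)) ->
  nbhs x [set y : prod_topology T | forall i, V i (y i)].
Proof.
move=> xV; have h i : nbhs x [set y : prod_topology T | V i (y i)].
  exact: (@proj_continuous I T i x _ (xV i)).
exact: (@filter_forall _ I (fun i y => V i (y i)) (nbhs x) _ h).
Qed.

(** An ultrafilter converges to each of its cluster points, and a compact interval provides one. *)
Lemma ultrafilter_lim (R : realType) (U : set_system nat) (f : nat -> R) (B : R) :
  UltraFilter U -> (forall n, `|f n| <= B) -> exists l : R, f @ U --> l.
Proof.
move=> UU fB.
have Uf : U (f @^-1` `[- B, B]%classic).
  by apply: filterE => n /=; rewrite in_itv/= -ler_norml.
have [l [_ cl]] := @segment_compact R (- B) B (f @ U) (fmap_proper_filter f _) Uf.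
exists l => W lW; have [//|UC] := in_ultra_setVsetC (f @^-1` W) UU.
by have [z [nWz Wz]] := cl (~` W) W UC lW.
Qed.

(** * Conjugation with respect to the cost, and potentials *)

Section Conjugate.
Context (R : realType) (m : nat) (M : 'I_m.+1 -> smoothManifold R)
  (mu : forall i, probability (borel (M i)) R).
Hypothesis mu_compact : forall i, compactly_supported (mu i).
Context (c : mprod M -> R).
Hypothesis c_continuous : continuous c.

Let K : set (mprod M) := spts mu.

Definition subst1 (y : mprod M) i (x : M i) : mprod M := @dfwith 'I_m.+1 M y i x.

Lemma subst1_id y i : subst1 y (y i) = y.
Proof. by apply/functional_extensionality_dep => j; rewrite /subst1; case: dfwithP. Qed.

Lemma subst1_spts y i (x : M i) : K y -> spt mu x -> K (subst1 y x).
Proof. by move=> Ky Kx j; rewrite /subst1; case: dfwithP. Qed.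

(** A ball condition for the pseudometric that c induces on the i-th factor: the sup distance over K
    between slices of c. *)
Definition close i (e : R) (x x' : M i) :=
  forall y, K y -> `|c (subst1 y x) - c (subst1 y x')| <= e.

Lemma subst1_continuous2 y i (x : M i) (U : set (mprod M)) :
  nbhs (subst1 y x) U -> \forall z \near y & x' \near x, U (subst1 z x').
Proof.
move=> /nbhs_prod_box[V xV VU].
exists ([set z : mprod M | forall j, j != i -> V j (z j)], V i).
  split=> /=; last by have := xV i; rewrite /subst1 dfwithin.
  apply: (@nbhs_box _ M y (fun j z => j != i -> V j z)) => j.
  have [->|ji] := eqVneq j i; first exact: nearW.
  have := xV j; rewrite /subst1 dfwithout 1?eq_sym// => h.
  by apply: filterS h => z + _.
move=> [z x'] /= [Vz Vx']; apply: VU => j.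
have [->|ji] := eqVneq j i; first by rewrite /subst1 dfwithin.
by rewrite /subst1 dfwithout 1?eq_sym//; exact: Vz.
Qed.

(** A tube argument: joint continuity near each point of the compact K makes the estimate uniform in
    y. *)
Lemma near_close i (x0 : M i) e : 0 < e -> \forall x \near x0, close e x x0.
Proof.
move=> e0.
have /compact_near_coveringP := spts_compact mu_compact.
move=> /(_ _ (nbhs x0) (fun x y => `|c (subst1 y x) - c (subst1 y x0)| <= e)); apply.
move=> y Ky.
have e2 : 0 < e / 2 by rewrite divr_gt0.
have nU : nbhs (subst1 y x0) (c @^-1` ball (c (subst1 y x0)) (e / 2)).
  by apply: c_continuous; exact: nbhsx_ballx.
have [[A B] /= [yA xB] AB] := subst1_continuous2 nU.
exists (A, B) => // -[z x] /= [Az Bx].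
have h1 := AB (z, x) (conj Az Bx); have h2 := AB (z, x0) (conj Az (nbhs_singleton xB)).
move: h1 h2; rewrite /= /ball/= => h1 h2.
rewrite (le_trans (ler_distD (c (subst1 y x0)) _ _))//.
by rewrite [leRHS](splitr e) lerD// ltW// distrC.
Qed.

Lemma close_exists i (x x' : M i) : exists e, close e x x'.
Proof.
pose f y := c (subst1 y x) - c (subst1 y x').
have fc : continuous f.
  move=> y; apply: cvgB.
    by apply: continuous_comp; [|exact: c_continuous] => U /subst1_continuous2[[A B] /= [yA xB] AB];
      apply: filterS yA => z Az; exact: (AB (z, x) (conj Az (nbhs_singleton xB))).
  by apply: continuous_comp; [|exact: c_continuous] => U /subst1_continuous2[[A B] /= [yA xB] AB];
      apply: filterS yA => z Az; exact: (AB (z, x') (conj Az (nbhs_singleton xB))).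
have [_ [B fB]] := bounded_measurable_continuous mu_compact fc.
by exists B => y Ky; exact: fB.
Qed.

Lemma close_spt : exists B, forall i (x x' : M i), spt mu x -> spt mu x' -> close B x x'.
Proof.
have [_ [B cB]] := bounded_measurable_continuous mu_compact c_continuous.
exists (B + B) => i x x' Kx Kx' y Ky; rewrite (le_trans (ler_normB _ _))//.
by apply: lerD; apply: cB; exact: subst1_spts.
Qed.

Lemma spts_nonempty : K !=set0.
Proof.
have h i : exists x, spt mu (i := i) x.
  by have [x [Kx _]] := spt_le_integ (bmeas_cst mu i 0) ltr01; exists x.
by exists (fun i => sval (cid (h i))) => i; exact: svalP (cid (h i)).
Qed.

(* The modulus of continuity of c in its i-th variable, uniformly in the others,
   stated without a metric. *)
Definition potential i (u : M i -> R) :=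
  forall e (x x' : M i), close e x x' -> `|u x - u x'| <= e.

Lemma potential_continuous i (u : M i -> R) : potential u -> continuous u.
Proof.
move=> pu x; apply/cvgrPdist_le => e e0; have := near_close x e0.
by apply: filterS => z /pu; rewrite distrC.
Qed.

Lemma potential_bmeas i (u : M i -> R) : potential u -> bmeas mu (u : borel (M i) -> R).
Proof.
move=> pu; split; first by apply: continuous_measurable_real; exact: potential_continuous.
have [B hB] := close_spt; have [k Kk] := spts_nonempty.
exists (`|u (k i)| + B) => x Kx; rewrite -[u x](subrK (u (k i))) addrC.
by rewrite (le_trans (ler_normD _ _))// lerD2l; apply: pu; apply: hB => //; exact: Kk.
Qed.

Definition family := forall i, M i -> R.
Implicit Types v : family.

Definition minorant v := (forall i, bmeas mu (v i : borel (M i) -> R)) /\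
  forall x, K x -> \sum_i v i (x i) <= c x.

Definition conj_set v i (x : M i) :=
  [set c (subst1 y x) - \sum_(j | j != i) v j (y j) | y in K].

(** The c-transform of the other members of the family. *)
Definition conjugate v i (x : M i) : R := inf (conj_set v x).

Definition update v i (u : M i -> R) : family :=
  @dfwith 'I_m.+1 (fun i => M i -> R) v i u.

Lemma conj_has_inf v i (x : M i) : minorant v -> has_inf (conj_set v x).
Proof.
move=> [hv vc]; split.
  by have [k Kk] := spts_nonempty; exists (c (subst1 k x) - \sum_(j | j != i) v j (k j)), k.
have [k Kk] := spts_nonempty.
(* The minorant inequality bounds the set from below at the support point [k i]; the closeness e
   carries the bound to an arbitrary x of the manifold. *)
have [e he] := close_exists x (k i).
exists (v i (k i) - e) => _ [y Ky <-].
have := vc (subst1 y (k i)) (subst1_spts Ky (Kk i)).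
have := he y Ky; rewrite ler_distlC => /andP[_ +].
rewrite (bigD1 i)//= /subst1 dfwithin.
under eq_bigr => j ji do rewrite dfwithout 1?eq_sym//.
lra.
Qed.

Lemma conjugate_le v i (x : M i) y : minorant v -> K y ->
  conjugate v x <= c (subst1 y x) - \sum_(j | j != i) v j (y j).
Proof. by move=> hv Ky; apply: ge_inf; [exact: (conj_has_inf x hv).2|exists y]. Qed.

Lemma conjugate_potential v i : minorant v -> potential (@conjugate v i).
Proof.
move=> hv e.
have le (x x' : M i) : close e x x' -> conjugate v x - e <= conjugate v x'.
  move=> xx'; apply: lb_le_inf; first exact: (conj_has_inf x' hv).1.
  move=> _ [y Ky <-]; have := conjugate_le x hv Ky.
  by have := xx' y Ky; rewrite ler_distlC => /andP[h1 h2]; lra.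
move=> x x' xx'; have x'x : close e x' x by move=> y Ky; rewrite distrC; exact: xx'.
by rewrite ler_distlC; apply/andP; split; have := le _ _ xx'; have := le _ _ x'x; lra.
Qed.

Lemma le_conjugate v i (x : M i) : minorant v -> spt mu x -> v i x <= conjugate v x.
Proof.
move=> hv Kx; apply: lb_le_inf; first exact: (conj_has_inf x hv).1.
move=> _ [y Ky <-]; rewrite lerBrDr.
have := hv.2 (subst1 y x) (subst1_spts Ky Kx); apply: le_trans.
rewrite [leRHS](bigD1 i)//= /subst1 dfwithin lerD2l.
by under [leRHS] eq_bigr => j ji do rewrite dfwithout 1?eq_sym//.
Qed.

Lemma update_minorant v i : minorant v -> minorant (update v (@conjugate v i)).
Proof.
move=> hv; split=> [j|x Kx].
  rewrite /update; case: dfwithP => [|k _]; last exact: hv.1.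
  by apply: potential_bmeas; exact: conjugate_potential.
rewrite (bigD1 i)//= /update dfwithin.
under eq_bigr => j ji do rewrite dfwithout 1?eq_sym//.
have := conjugate_le (x i) hv Kx; rewrite subst1_id; lra.
Qed.

Definition value v : R := \sum_i integ mu (v i : borel (M i) -> R).

Lemma le_value_update v i : minorant v -> value v <= value (update v (@conjugate v i)).
Proof.
move=> hv; apply: ler_sum => j _; rewrite /update; case: dfwithP => [|k _] //.
apply: le_mean; [exact: spt_measurable|exact: hv.1| |].
  by apply: potential_bmeas; exact: conjugate_potential.
by move=> x Kx; exact: le_conjugate.
Qed.

(** The coordinates are conjugated one after another; no step lowers the value, and each changes
    only its own coordinate. *)
Lemma potential_minorant v : minorant v ->
  exists2 v', minorant v' & value v <= value v' /\ forall i, potential (v' i).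
Proof.
move=> hv.
suff [v' [hv' vv' pv']] : exists v', [/\ minorant v', value v <= value v' &
    forall i, i \in enum 'I_m.+1 -> potential (v' i)].
  by exists v' => //; split => // i; apply: pv'; rewrite mem_enum.
elim: (enum _) => [|i s [v' [hv' vv' pv']]]; first by exists v.
exists (update v' (@conjugate v' i)); split; first exact: update_minorant.
  exact: le_trans vv' (le_value_update i hv').
move=> j; rewrite inE /update; case: dfwithP => [_|k ik].
  exact: conjugate_potential.
by rewrite eq_sym (negbTE ik)/=; exact: pv'.
Qed.

End Conjugate.

(** * Attainment of the dual problem *)

Section Attainment.
Context (R : realType) (m : nat) (M : 'I_m.+1 -> smoothManifold R)
  (mu : forall i, probability (borel (M i)) R).
Hypothesis mu_compact : forall i, compactly_supported (mu i).
Context (c : mprod M -> R).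
Hypothesis c_continuous : continuous c.

Let K : set (mprod M) := spts mu.
Let D : R := - dual mu (- c).

Lemma bounded_sptsN_cost : bounded_spts mu (- c).
Proof.
have [_ [B cB]] := bounded_measurable_continuous mu_compact c_continuous.
by exists B => x Kx; rewrite fctE normrN cB.
Qed.

Lemma near_optimal_potential e : 0 < e -> exists v : family M,
  [/\ minorant mu c v, D - e <= value mu v & forall i, potential mu c (v i)].
Proof.
move=> e0; have [_ [u [hu uc] <-] ue] := inf_adherent e0 (dual_has_inf bounded_sptsN_cost).
(* A majorant of [- c], negated, is a minorant of c. *)
pose v : family M := fun i x => -1 * u i x.
have hv : minorant mu c v.
  split=> [i|x Kx]; first exact: (bounded_measurableZ (-1) (hu i)).
  by rewrite -mulr_sumr mulN1r lerNl; exact: uc.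
have [v' hv' [vv' pv']] := potential_minorant mu_compact c_continuous hv.
exists v'; split => //; apply: le_trans vv'.
rewrite /value (eq_bigr (fun i => -1 * integ mu (u i))); last first.
  by move=> i _; rewrite -integZ.
by rewrite -mulr_sumr mulN1r /D /dual; move: ue; lra.
Qed.

(** Functions that vanish at k are bounded at x by any e for which x and k are close; the modulus of
    continuity passes to the limit. *)
Lemma limit_potential (U : set_system nat) i (w : nat -> M i -> R) (k : M i) :
  UltraFilter U -> (forall n, potential mu c (w n)) -> (forall n, w n k = 0) ->
  exists2 l : M i -> R, potential mu c l & forall x, w ^~ x @ U --> l x.
Proof.
move=> UU pw wk.
have lim x : exists l : R, w ^~ x @ U --> l.
  have [e he] := close_exists mu_compact c_continuous x k.
  apply: (@ultrafilter_lim _ _ _ e) => n.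
  by have := pw n _ _ _ he; rewrite wk subr0.
exists (fun x => sval (cid (lim x))); last by move=> x; exact: svalP (cid (lim x)).
move=> e x x' xx'.
have cv : (fun n => `|w n x - w n x'|) @ U --> `|sval (cid (lim x)) - sval (cid (lim x'))|.
  by apply: cvg_norm; apply: cvgB; exact: svalP (cid (lim _)).
apply: (closed_cvg (fun z : R => z <= e)) cv; first exact: closed_le.
by apply: filterE => n; exact: pw.
Qed.

(* Equicontinuity upgrades pointwise to uniform convergence on the compact
   support, hence the integrals converge. *)
Lemma limit_integ (U : set_system nat) i (w : nat -> M i -> R) (l : M i -> R) :
  UltraFilter U -> (forall n, potential mu c (w n)) -> potential mu c l ->
  (forall x, w ^~ x @ U --> l x) ->
  (fun n => integ mu (w n : borel (M i) -> R)) @ U --> integ mu (l : borel (M i) -> R).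
Proof.
move=> UU pw pl wl; apply/cvgrPdist_le => e e0.
have e3 : 0 < e / 3 by lra.
have unif : \forall n \near U, spt mu (i := i) `<=` (fun x => `|l x - w n x| <= e).
  have /compact_near_coveringP := mu_compact (i := i).
  move=> /(_ _ U (fun n x => `|l x - w n x| <= e)); apply => x Kx.
  have nx : nbhs x [set x' | close mu c (e / 3) x' x].
    by apply: near_close.
  have nU : U [set n | `|l x - w n x| <= e / 3].
    by have /cvgrPdist_le/(_ _ e3) := wl x.
  exists ([set x' | close mu c (e / 3) x' x], [set n | `|l x - w n x| <= e / 3]) => //.
  move=> [x' n] /= [h1 h2].
  have := pl _ _ _ h1; have := pw n _ _ _ h1; move: h2; rewrite !ler_norml.
  by move=> /andP[? ?] /andP[? ?] /andP[? ?]; apply/andP; split; lra.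
apply: filterS unif => n hn.
have bl := potential_bmeas mu_compact c_continuous pl.
have bw := potential_bmeas mu_compact c_continuous (pw n).
have shift (u : borel (M i) -> R) a : bmeas mu u ->
    bmeas mu (fun x => u x + a) /\ integ mu (fun x => u x + a) = integ mu u + a.
  move=> hu; split; first by apply: bounded_measurableD => //; exact: bounded_measurable_cst.
  by rewrite integD ?integ_cst//; exact: bmeas_cst.
have [s1 s2] := shift _ e bw; have [s3 s4] := shift _ (- e) bw.
rewrite ler_norml; apply/andP; split.
  rewrite lerBrDl -s4; apply: le_mean => //; first exact: spt_measurable.
  by move=> x /hn; rewrite ler_norml => /andP[? ?]; lra.
rewrite lerBlDl -s2; apply: le_mean => //; first exact: spt_measurable.
by move=> x /hn; rewrite ler_norml => /andP[? ?]; lra.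
Qed.

Lemma dual_attained : exists v : family M,
  [/\ minorant mu c v, forall i, potential mu c (v i), D <= value mu v &
      forall (x : M ord0) y, K y ->
        v ord0 x + \sum_(j | j != ord0) v j (y j) <= c (subst1 y x)].
Proof.
suff [v [hv pv Dv]] : exists v : family M,
    [/\ minorant mu c v, forall i, potential mu c (v i) & D <= value mu v].
  (* A last conjugation of the first member yields its inequality at every x, inside the support or
     not. *)
  exists (update v (conjugate mu c v (i := ord0))); split.
  - exact: update_minorant.
  - move=> i; rewrite /update; case: dfwithP => [|j _]; last exact: pv.
    exact: conjugate_potential.
  - by apply: (le_trans Dv); exact: le_value_update.
  - move=> x y Ky; rewrite /update dfwithin.
    under eq_bigr => j ji do rewrite dfwithout 1?eq_sym//.
    by rewrite -lerBrDr; exact: conjugate_le.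
have e_gt0 n : (0 : R) < n.+1%:R^-1 by rewrite invr_gt0 ltr0n.
pose V n := sval (cid (near_optimal_potential (e_gt0 n))).
have VP n : [/\ minorant mu c (V n), D - n.+1%:R^-1 <= value mu (V n) &
    forall i, potential mu c (V n i)] := svalP (cid (near_optimal_potential (e_gt0 n))).
have [k Kk] := spts_nonempty mu.
have [U [UU oU]] := ultraFilterLemma (eventually_filter : ProperFilter \oo).
(* The members are normalized at support points; convergence of the constants removed here is never
   established. *)
pose w n i (x : M i) := V n i x - V n i (k i).
have pw i n : potential mu c (w n i).
  move=> e x x' xx'; have [_ _ /(_ i)/(_ e x x' xx')] := VP n.
  by rewrite /w opprB addrA subrK.
have wk n i : w n i (k i) = 0 by rewrite /w subrr.
have lim i : exists2 l : M i -> R, potential mu c l &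
    forall x, (fun n => w n i x) @ U --> l x.
  by apply: (limit_potential UU (pw i)) => n; exact: wk.
pose l : family M := fun i => s2val (cid2 (lim i)).
have pl i : potential mu c (l i) := s2valP (cid2 (lim i)).
have wl i x : (fun n => w n i x) @ U --> l i x := s2valP' (cid2 (lim i)) x.
pose b : R := value mu l.
have cvgb : (fun n => value mu (w n)) @ U --> b.
  by apply: cvg_big => [|i _]; [exact: add_continuous|exact: limit_integ].
have cvg1 : (fun n => n.+1%:R^-1 : R) @ U --> (0 : R).
  by apply: cvg_trans (@cvg_harmonic R); exact: cvg_app.
have shift i (v : borel (M i) -> R) a : bmeas mu v -> bmeas mu (fun x => v x + a) /\
    integ mu (fun x => v x + a) = integ mu v + a.
  move=> hu; split; first by apply: bounded_measurableD => //; exact: bounded_measurable_cst.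
  by rewrite integD ?integ_cst//; exact: bmeas_cst.
have bw n i : bmeas mu (w n i : borel (M i) -> R) by exact: potential_bmeas.
have bl i : bmeas mu (l i : borel (M i) -> R) by exact: potential_bmeas.
have wE n : value mu (V n) = value mu (w n) + \sum_i V n i (k i).
  rewrite /value -big_split/=; apply: eq_bigr => i _.
  rewrite -(shift i _ (V n i (k i)) (bw n i)).2; congr integ.
  by apply/funext => x; rewrite subrK.
(* The removed constants add up to at least D - 1/(n+1) - [value mu (w n)], which tends to D - b;
   this lower bound suffices in the limit. *)
have low x : K x -> D - b + \sum_i l i (x i) <= c x.
  move=> Kx.
  have cv : (fun n => (D - n.+1%:R^-1 - value mu (w n)) + \sum_i w n i (x i)) @ U -->
     (D - 0 - b) + \sum_i l i (x i).
    apply: cvgD; last by apply: cvg_big => [|i _]; [exact: add_continuous|exact: wl].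
    by apply: cvgB => //; apply: cvgB => //; exact: cvg_cst.
  rewrite subr0 in cv.
  apply: (closed_cvg (fun z : R => z <= c x)) cv; first exact: closed_le.
  apply: filterE => n /=; have [[_ /(_ x Kx) h1] h2 _] := VP n.
  apply: le_trans h1; rewrite wE in h2.
  rewrite [leRHS](eq_bigr (fun i => w n i (x i) + V n i (k i))); last first.
    by move=> i _; rewrite subrK.
  by rewrite [leRHS]big_split [leRHS]addrC lerD2r lerBlDl.
(* Giving D - b to the first member raises the value from b to D. *)
pose v : family M := fun i x => l i x + (if i == ord0 then D - b else 0).
have vE (x : mprod M) : \sum_i v i (x i) = D - b + \sum_i l i (x i).
  by rewrite big_split/= -big_mkcond/= big_pred1_eq addrC.
exists v; split.
- split=> [i|x Kx]; last by rewrite vE low.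
  exact: (shift i _ _ (bl i)).1.
- by move=> i e x x' xx'; rewrite /v opprD addrACA subrr addr0; exact: pl.
- rewrite /value (eq_bigr (fun i => integ mu (l i) + (if i == ord0 then D - b else 0))).
    by rewrite big_split/= -big_mkcond/= big_pred1_eq addrC -/(value mu l) subrK.
  by move=> i _; exact: (shift i _ _ (bl i)).2.
Qed.

End Attainment.

(** * Kinks and differentiability *)

(** The preimage of an open set is a countable union of preimages of rational cubes, and each of
    these is a finite intersection of coordinate conditions. *)
Lemma measurable_fun_rV d (T : measurableType d) (R : realType) n
    (f : T -> 'rV[R]_n) :
  (forall i, measurable_fun setT (fun t => f t ord0 i)) ->
  measurable_fun setT (f : T -> borel 'rV[R]_n).
Proof.
move=> mf.
apply: (@measurability _ _ T (borel 'rV[R]_n) setT f (@open 'rV[R]_n)) => //.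
move=> _ [U oU <-]; rewrite setTI.
pose q (p : 'rV[rat]_n) : 'rV[R]_n := map_mx (@ratr R) p.
pose F (pk : 'rV[rat]_n * nat) := if `[< ball (q pk.1) pk.2.+1%:R^-1 `<=` U >]
  then [set t | forall i, ball (q pk.1 ord0 i) pk.2.+1%:R^-1 (f t ord0 i)] else set0.
have -> : f @^-1` U = \bigcup_pk F pk.
  apply/seteqP; split => t; last first.
    move=> [pk _]; rewrite /F; case: asboolP => // pkU h; apply: pkU.
    by split => // i j; rewrite (ord1 i).
  move=> /= Uf; have /nbhs_ballP[e /= e0 eU] : nbhs (f t) U.
    by apply: open_nbhs_nbhs.
  (* A cube of half-side s around a rational point within s of [f t] stays within 2 s < e of
     [f t]. *)
  have e2 : 0 < e / 2 by rewrite divr_gt0.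
  have [k ke] := filter_ex (near_infty_natSinv_lt (PosNum e2)).
  have [s sE] : exists s : R, s = k.+1%:R^-1 by exists k.+1%:R^-1.
  have s0 : 0 < s by rewrite sE invr_gt0 ltr0n.
  have {}ke : s < e / 2 by rewrite sE.
  have hr i : exists r : rat, ball (ratr r : R) s (f t ord0 i).
    have lt : f t ord0 i - s < f t ord0 i + s by lra.
    have [r] := rat_in_itvoo lt.
    rewrite in_itv/= => /andP[h1 h2]; exists r.
    by rewrite /ball/= ltr_norml; apply/andP; split; lra.
  pose p : 'rV[rat]_n := \row_i sval (cid (hr i)).
  have hp i : ball (q p ord0 i) s (f t ord0 i).
    by rewrite /q !mxE; exact: svalP (cid (hr i)).
  exists (p, k) => //; rewrite /F -sE asboolT//= => v [_ hv].
  apply: eU; split => // i j; rewrite (ord1 i).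
  have := hp j; have := hv ord0 j; rewrite /ball/= !ltr_norml.
  by move=> /andP[? ?] /andP[? ?]; apply/andP; split; lra.
apply: countable_bigcupT_measurable; first exact: countableP.
move=> [p k]; rewrite /F; case: asboolP => _ //=.
rewrite (_ : [set t | _] = \big[setI/setT]_(i < n)
    ((fun t => f t ord0 i) @^-1` ball (q p ord0 i) k.+1%:R^-1)); last first.
  rewrite -bigcap_seq; apply/seteqP; split => z /= h i; first by move=> _; exact: h.
  by apply: h; rewrite /= mem_index_enum.
apply: bigsetI_measurable => i _; rewrite -[X in measurable X]setTI; apply: mf => //.
exact: measurable_ball.
Qed.

Lemma measurable_rV_coord (R : realType) n i :
  measurable_fun setT (fun v : borel 'rV[R]_n => (v : 'rV[R]_n) ord0 i).
Proof. by apply: continuous_measurable_real => v; exact: coord_continuous. Qed.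

(** * Lebesgue measure on row vectors and sets that are null on lines *)

Definition cons_rV (R : realType) n (xv : measurableTypeR R * borel 'rV[R]_n) : borel 'rV[R]_n.+1 :=
  row_mx (xv.1%:M : 'rV[R]_1) (xv.2 : 'rV[R]_n).

Lemma cons_rVE (R : realType) n (x : R) (v : 'rV[R]_n) (i : 'I_n.+1) :
  (cons_rV (x, v) : 'rV[R]_n.+1) ord0 i = if unlift ord0 i is Some j then v ord0 j else x.
Proof.
rewrite /cons_rV mxE /=; case: unliftP => [j ->|->].
  case: splitP => k; first by rewrite (ord1 k) lift0.
  by rewrite lift0 add1n => -[/val_inj ->].
by case: splitP => k //; rewrite (ord1 k) mxE eqxx mulr1n.
Qed.

Lemma measurable_cons_rV (R : realType) n : measurable_fun setT (@cons_rV R n).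
Proof.
apply: measurable_fun_rV => i.
rewrite (_ : (fun _ => _) = fun xv : measurableTypeR R * borel 'rV[R]_n =>
    if unlift ord0 i is Some j then (xv.2 : 'rV[R]_n) ord0 j else xv.1); last first.
  by apply/funext => -[x v]; exact: cons_rVE.
case: unlift => [j|]; last exact: measurable_fst.
exact: (measurableT_comp (measurable_rV_coord j) measurable_snd).
Qed.

Lemma measurable_cons_rV2 (R : realType) n (x : R) :
  measurable_fun setT (fun v : borel 'rV[R]_n => cons_rV (x, v)).
Proof. by apply: measurableT_comp; [exact: measurable_cons_rV|exact: measurable_pair1]. Qed.

Definition tail_rV (R : realType) n (v : borel 'rV[R]_n.+1) : measurableTypeR R * borel 'rV[R]_n :=
  ((v : 'rV[R]_n.+1) ord0 ord0, \row_i (v : 'rV[R]_n.+1) ord0 (lift ord0 i)).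

Lemma measurable_tail_rV (R : realType) n : measurable_fun setT (@tail_rV R n).
Proof.
apply: measurable_fun_pair; first exact: measurable_rV_coord.
by apply: measurable_fun_rV => i; under eq_fun do rewrite mxE; exact: measurable_rV_coord.
Qed.

Lemma cons_rVK (R : realType) n : cancel (@cons_rV R n) (@tail_rV R n).
Proof.
move=> [x v]; rewrite /tail_rV !cons_rVE unlift_none; congr pair.
by apply/rowP => i; rewrite mxE cons_rVE liftK.
Qed.

(** The iterated integral is the image of a product measure under [cons_rV]; sigma-finiteness is
    carried along for the product in the next dimension. *)
Lemma lebesgue_rV_measure (R : realType) n :
  exists nu : {sigma_finite_measure set (borel 'rV[R]_n) -> \bar R},
    forall A : set (borel 'rV[R]_n), measurable A -> nu A = lebesgue_rV (A : set 'rV[R]_n).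
Proof.
elim: n => [|n [nu nuE]].
  by exists (@dirac _ (borel 'rV[R]_0) 0 R) => A mA.
pose f := @cons_rV R n; have mf := @measurable_cons_rV R n.
pose leb : {sigma_finite_measure set (measurableTypeR R) -> \bar R} := @lebesgue_measure R.
pose p : {measure set (measurableTypeR R * borel 'rV[R]_n)%type -> \bar R} :=
  (leb \x nu)%E.
pose q : {measure set (borel 'rV[R]_n.+1) -> \bar R} :=
  measure_function_pushforward__canonical__measure_function_Measure p mf.
have qT : sigma_finite setT q.
  have /sigma_finiteP[F [FT ndF Foo]] := sigma_finiteT leb.
  have /sigma_finiteP[G [GT ndG Goo]] := sigma_finiteT nu.
  exists (fun k => @tail_rV R n @^-1` (F k `*` G k)).
    rewrite -preimage_bigcup (_ : \bigcup_k (F k `*` G k) = setT) ?preimage_setT//.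
    rewrite -subTset => -[x v] _.
    have [[j _ Fx] [k _ Gv]] : (\bigcup_i F i) x /\ (\bigcup_i G i) v by rewrite -FT -GT.
    exists (maxn j k) => //; split.
      by move: x Fx; exact/subsetPset/ndF/leq_maxl.
    by move: v Gv; exact/subsetPset/ndG/leq_maxr.
  move=> k; have [mF Fk] := Foo k; have [mG Gk] := Goo k; split.
    rewrite -[X in measurable X]setTI.
    by apply: measurable_tail_rV => //; exact: measurableX.
  rewrite /q/= /pushforward -comp_preimage (_ : _ \o _ = id); last first.
    by apply/funext => xv; exact: cons_rVK.
  by rewrite preimage_id /p/= product_measure1E// lte_mul_pinfty// ge0_fin_numE.
pose q' := HB.pack_for (sigma_finite_measure (borel 'rV[R]_n.+1) R) (Measure.sort q)
  (Measure_isSigmaFinite.Build _ _ _ (Measure.sort q) qT).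
exists q' => A mA.
rewrite /= /pushforward /product_measure1; apply: eq_integral => x _ /=.
rewrite -nuE; first by rewrite xsectionE.
rewrite -[X in measurable X]setTI; exact: (measurable_cons_rV2 x).
Qed.

Lemma cons_rV_lift (R : realType) n (x t : R) (v : 'rV[R]_n) (j : 'I_n) :
  (cons_rV (x, v + t *: delta_mx ord0 j) : 'rV[R]_n.+1) =
  (cons_rV (x, v) : 'rV[R]_n.+1) + t *: delta_mx ord0 (lift ord0 j).
Proof.
apply/rowP => i; rewrite cons_rVE.
rewrite [RHS]mxE cons_rVE [X in _ = _ + X]mxE [X in _ = _ + _ * X]mxE.
case: unliftP => [k ->|->]; last by rewrite /= mulr0 addr0.
by rewrite !mxE /= (inj_eq (@lift_inj _ ord0)).
Qed.

Lemma cons_rV_head (R : realType) n (t : R) (v : 'rV[R]_n) :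
  (cons_rV (t, v) : 'rV[R]_n.+1) =
  (cons_rV (0, v) : 'rV[R]_n.+1) + t *: delta_mx ord0 ord0.
Proof.
apply/rowP => i; rewrite cons_rVE.
rewrite [RHS]mxE cons_rVE [X in _ = _ + X]mxE [X in _ = _ + _ * X]mxE.
by case: unliftP => [k ->|->]; rewrite /= ?mulr0 ?addr0// mulr1 add0r.
Qed.

(** If the axis is not the first, slicing by the first coordinate keeps the lines and induction
    applies; if it is, the order of integration is exchanged. *)
Lemma lebesgue_rV_lines0 (R : realType) n (A : set (borel 'rV[R]_n)) (i : 'I_n) :
  measurable A ->
  (forall v : 'rV[R]_n, @lebesgue_measure R
     [set t | A (v + t *: delta_mx ord0 i)] = 0%E) ->
  lebesgue_rV (A : set 'rV[R]_n) = 0%E.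
Proof.
elim: n A i => [A [] //|n IH A i mA A0].
case: (unliftP ord0 i) A0 => [j ->|->] A0.
  apply: integral0_eq => x _; apply: (IH _ j).
    by rewrite -[X in measurable X]setTI; exact: (measurable_cons_rV2 x).
  move=> v; rewrite -[RHS](A0 (cons_rV (x, v))); congr (lebesgue_measure _).
  by apply/seteqP; split => t /=; rewrite -cons_rV_lift.
have [nu nuE] := lebesgue_rV_measure R n.
pose leb : {sigma_finite_measure set (measurableTypeR R) -> \bar R} := @lebesgue_measure R.
pose B : set (measurableTypeR R * borel 'rV[R]_n) := @cons_rV R n @^-1` A.
have mB : measurable B.
  by rewrite -[X in measurable X]setTI; exact: measurable_cons_rV.
have -> : lebesgue_rV (A : set 'rV[R]_n.+1) = product_measure1 leb nu B.
  apply/esym; rewrite /product_measure1; apply: eq_integral => x _ /=.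
  rewrite xsectionE; apply: nuE.
  by rewrite -[X in measurable X]setTI; exact: (measurable_cons_rV2 x).
rewrite (@product_measure_unique _ _ _ _ _ leb nu (product_measure2 leb nu))//; last first.
  by move=> A1 A2 mA1 mA2; exact: product_measure2E.
apply: integral0_eq => v _ /=; rewrite ysectionE -[RHS](A0 (cons_rV (0, v))).
congr (lebesgue_measure _).
by apply/seteqP; split => t; rewrite /B/= (cons_rV_head t).
Qed.

(** * Kinks along a coordinate axis *)

Section Kink.
Context (R : realType) (n : nat).
Implicit Types (phi : 'rV[R]_n -> R) (O : set 'rV[R]_n) (i : 'I_n).

Let E i : 'rV[R]_n := delta_mx ord0 i.

(* The graph of phi has, along the i-th axis, a concave kink at p: right
   slopes at most a and left slopes at least b, where a < b. *)
Definition kink phi O i (a b r : R) : set 'rV[R]_n :=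
  [set p | ball p r `<=` O /\ forall h, 0 < h < r ->
    phi (p + h *: E i) - phi p <= a * h /\ b * h <= phi p - phi (p - h *: E i)].

Lemma ball_axis (p : 'rV[R]_n) i (h r : R) : 0 < r -> `|h| < r -> ball p r (p + h *: E i).
Proof.
move=> r0 hr; split => // k j; rewrite (ord1 k) /ball/= !mxE eqxx /=.
rewrite opprD addrA subrr sub0r normrN; case: eqP => _; first by rewrite mulr1.
by rewrite mulr0 normr0.
Qed.

Lemma closure_le0 (S : set 'rV[R]_n) (f : 'rV[R]_n -> R) p :
  {for p, continuous f} -> (forall z, S z -> f z <= 0) -> closure S p -> f p <= 0.
Proof.
move=> cf Sf clp; rewrite leNgt; apply/negP => fp0.
have n0 : nbhs p [set q | 0 < f q] by exact: (cvgr_gt _ cf).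
by have [z [/Sf + /=]] := clp _ n0; rewrite leNgt => /negP.
Qed.

(** This makes kink sets Borel. The ball being open, its inclusion in O passes to limits, and the
    slope bounds are closed conditions. *)
Lemma kink_closed phi O i a b r : 0 < r -> {in O, continuous phi} ->
  closed (kink phi O i a b r).
Proof.
move=> r0 cphi.
have cshift (p w : 'rV[R]_n) : O (p + w) -> {for p, continuous (fun q : 'rV[R]_n => phi (q + w))}.
  move=> Op; apply: (@continuous_comp _ _ _ (fun q : 'rV[R]_n => q + w : 'rV[R]_n) phi).
    by apply: continuousD; [exact: cvg_id|exact: cst_continuous].
  exact: (cphi _ (mem_set Op)).
move=> p clp.
have bO : ball p r `<=` O.
  move=> q pq; have nq : nbhs p (ball q r).
    apply: open_nbhs_nbhs; split; last exact: ball_sym.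
    exact: ball_open.
  by have [z [[zO _] qz]] := clp _ nq; apply: zO; exact: ball_sym.
have Oh h : `|h| < r -> O (p + h *: E i) by move=> hr; exact/bO/ball_axis.
have cp : {for p, continuous phi}.
  by apply: (cphi _ (mem_set _)); apply: bO; exact: ballxx.
split => // h /andP[h0 hr].
have nh : `|h| < r by rewrite ger0_norm ?ltW.
split.
  rewrite -subr_le0; apply: (@closure_le0 _ (fun q => phi (q + h *: E i) - phi q - a * h)) clp.
    apply: continuousB; last exact: cst_continuous.
    by apply: continuousB; [apply: cshift; exact: Oh|exact: cp].
  by move=> z [_ /(_ h)]; rewrite h0 hr subr_le0 => /(_ erefl)[].
rewrite -subr_le0.
apply: (@closure_le0 _ (fun q => b * h - (phi q - phi (q - h *: E i)))) clp.
  apply: continuousB; first exact: cst_continuous.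
  apply: continuousB; first exact: cp.
  by apply: cshift; rewrite -scaleNr; apply: Oh; rewrite normrN.
by move=> z [_ /(_ h)]; rewrite h0 hr subr_le0 => /(_ erefl)[].
Qed.

(* Two points of a kink set on a common line are at distance at least r, since
   the right slope at one of them is the left slope at the other. *)
Lemma kink_lines0 phi O i a b r (v : 'rV[R]_n) : 0 < r -> a < b ->
  @lebesgue_measure R [set t | kink phi O i a b r (v + t *: E i)] = 0%E.
Proof.
move=> r0 ab; apply: countable_lebesgue_measure0.
(* Two parameters in the same cell of length r are at distance less than r, so each cell holds at
   most one kink. *)
pose f (t : R) : int := Num.floor (t / r).
have finj : {in [set t | kink phi O i a b r (v + t *: E i)] &, injective f}.
  have key s t : kink phi O i a b r (v + s *: E i) -> kink phi O i a b r (v + t *: E i) ->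
      f s = f t -> s < t -> False.
    move=> [_ ks] [_ kt] fst st.
    have str : 0 < t - s < r.
      rewrite subr_gt0 st/=.
      have h1 : (f s)%:~R <= s / r by exact: floor_le.
      have h2 : t / r < (f t + 1)%:~R by exact: floorD1_gt.
      move: h1 h2; rewrite ler_pdivlMr// ltr_pdivrMr// fst intrD mulrDl mul1r; lra.
    have [_] := kt _ str; have [+ _] := ks _ str.
    have e1 : v + s *: E i + (t - s) *: E i = v + t *: E i.
      by rewrite -addrA -scalerDl [s + _]addrC subrK.
    rewrite e1 -{3}e1 addrK.
    have ts0 : 0 < t - s by rewrite subr_gt0.
    move=> h1 h2; have := le_trans h2 h1.
    by rewrite ler_pM2r// leNgt ab.
  move=> s t /set_mem ks /set_mem kt fst.
  have [st|ts|//] := ltgtP s t; exfalso; first exact: key st.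
  exact: key (esym fst) ts.
apply/countable_injP; exists (choice.pickle \o f) => s t sS tS /= fst; apply: finj => //.
exact: (pcan_inj choice.pickleK).
Qed.
End Kink.

(** * One-sided slopes of convex functions *)

Section ConvexAt.
Context (R : realType) (n : nat).
Implicit Types (G f : 'rV[R]_n -> R) (p v w : 'rV[R]_n).

Definition convex_near G p r := forall (t : R) x y, 0 <= t <= 1 ->
  ball p r x -> ball p r y -> G (t *: x + (1 - t) *: y) <= t * G x + (1 - t) * G y.

Lemma convex_function_near G p r :
  convex_function (ball p r : set 'rV[R]_n) (G : 'rV[R]_n -> R^o) -> convex_near G p r.
Proof.
move=> cG t x y t01 px py.
have := cG (@Itv01 R t (andP t01).1 (andP t01).2) x y (mem_set px) (mem_set py).
by [].
Qed.

Variables (G : 'rV[R]_n -> R) (p : 'rV[R]_n) (r : R).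
Hypotheses (r0 : 0 < r) (cG : convex_near G p r).

Lemma slope_le v (s t : R) : 0 < s <= t -> ball p r (p + t *: v) ->
  (G (p + s *: v) - G p) * t <= (G (p + t *: v) - G p) * s.
Proof.
move=> /andP[s0 st] pt; have t0 : 0 < t by exact: lt_le_trans st.
have [l sE] : exists l, s = l * t by exists (s / t); rewrite divfK// gt_eqF.
have l01 : 0 <= l <= 1.
  by move: s0 st; rewrite sE pmulr_lgt0// ger_pMl// => /ltW -> ->.
have := cG l01 pt (ballxx p r0).
have -> : l *: (p + t *: v) + (1 - l) *: p = p + s *: v.
  by rewrite scalerDr scalerA -sE scalerBl scale1r addrC addrA subrK.
by rewrite sE mulrA ler_pM2r//; lra.
Qed.

Lemma slope_opp v (s t : R) : 0 < s -> 0 < t -> ball p r (p + t *: v) ->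
  ball p r (p + s *: - v) ->
  0 <= s * (G (p + t *: v) - G p) + t * (G (p + s *: - v) - G p).
Proof.
move=> s0 t0 pt ps; have st0 : 0 < s + t by exact: addr_gt0.
have [l sE] : exists l, s = l * (s + t) by exists (s / (s + t)); rewrite divfK// gt_eqF.
have tE : t = (1 - l) * (s + t) by rewrite mulrBl -sE mul1r addrC addKr.
have l01 : 0 <= l <= 1.
  apply/andP; split; first by rewrite -(pmulr_lge0 _ st0) -sE ltW.
  by rewrite -subr_ge0 -(pmulr_lge0 _ st0) -tE ltW.
have := cG l01 pt ps.
have -> : l *: (p + t *: v) + (1 - l) *: (p + s *: - v) = p.
  rewrite scalerDr [X in _ + X]scalerDr addrACA -scalerDl.
  rewrite [l + _]addrC subrK scale1r !scalerA scalerN -scalerBl.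
  by rewrite {1}tE [in X in _ - X]sE mulrA mulrA [l * _]mulrC subrr scale0r addr0.
move=> H; set A := G _ - _; set C := G _ - _.
have -> : s * A + t * C = (s + t) * (l * A + (1 - l) * C).
  by rewrite [RHS]mulrDr !mulrA [(s + t) * l]mulrC [(s + t) * (1 - l)]mulrC -sE -tE.
by rewrite mulr_ge0//; [exact: ltW|rewrite /A /C; lra].
Qed.

(** The right derivative of G at p in the direction v: by convexity the quotients decrease to their
    infimum as h decreases to 0. *)
Definition slope v : R := inf [set (G (p + h *: v) - G p) / h | h in [set h | 0 < h < r]].

Definition in_ball v := forall h : R, `|h| < r -> ball p r (p + h *: v).

Lemma in_ballN v : in_ball v -> in_ball (- v).
Proof. by move=> hv h hr; rewrite scalerN -scaleNr; apply: hv; rewrite normrN. Qed.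

Lemma slope_has_inf v : in_ball v ->
  has_inf [set (G (p + h *: v) - G p) / h | h in [set h | 0 < h < r]].
Proof.
move=> vr; have r2 : 0 < r / 2 < r by have := r0; move=> ?; apply/andP; split; lra.
split; first by exists ((G (p + (r / 2) *: v) - G p) / (r / 2)), (r / 2).
have pr2 : ball p r (p + (r / 2) *: - v).
  by case/andP: r2 => ? ?; apply: (in_ballN vr); rewrite gtr0_norm.
(* The quotient at r/2 in the opposite direction, negated, bounds all quotients from below. *)
exists (- ((G (p + (r / 2) *: - v) - G p) / (r / 2))) => _ [h /andP[h0 hr] <-].
have ph : ball p r (p + h *: v) by apply: vr; rewrite ger0_norm// ltW.
have r20 : 0 < r / 2 by case/andP: r2.
have H := slope_opp r20 h0 ph pr2; rewrite -subr_ge0 opprK.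
rewrite -(pmulr_rge0 _ (mulr_gt0 r20 h0)); apply: le_trans H _.
by rewrite le_eqVlt; apply/orP; left; apply/eqP; field; rewrite !gt_eqF.
Qed.

Lemma slope_lb v h : in_ball v -> 0 < h < r -> slope v * h <= G (p + h *: v) - G p.
Proof.
move=> vr /andP[h0 hr]; rewrite -ler_pdivlMr//.
by apply: ge_inf; [exact: (slope_has_inf vr).2|exists h => //=; rewrite h0].
Qed.

Lemma slope_near v e : in_ball v -> 0 < e -> exists d, 0 < d /\ forall h, 0 < h < d ->
  G (p + h *: v) - G p <= (slope v + e) * h.
Proof.
move=> vr e0; have [_ [t /andP[t0 tr] <-] te] := inf_adherent e0 (slope_has_inf vr).
exists t; split => // h /andP[h0 ht].
have pt : ball p r (p + t *: v) by apply: vr; rewrite ger0_norm// ltW.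
have ht' : 0 < h <= t by rewrite h0 ltW.
have := slope_le ht' pt; rewrite -ler_pdivlMr// => /le_trans; apply.
by rewrite mulrAC ler_pM2r// ltW.
Qed.

Lemma slope_opp_ge0 v : in_ball v -> 0 <= slope v + slope (- v).
Proof.
move=> vr; apply/ler_addgt0Pr => e e0.
have e2 : 0 < e / 2 by lra.
have [d [d0 hd]] := slope_near vr e2; have [d' [d'0 hd']] := slope_near (in_ballN vr) e2.
pose h := Num.min (Num.min d d') r / 2.
have m0 : 0 < Num.min (Num.min d d') r by rewrite !lt_min d0 d'0 r0.
have h0 : 0 < h by rewrite divr_gt0.
have : h < Num.min (Num.min d d') r by rewrite /h; move: m0; set x := Num.min _ _; lra.
rewrite !lt_min => /andP[/andP[hd1 hd2] hr].
have h1 := hd h (introT andP (conj h0 hd1)); have h2 := hd' h (introT andP (conj h0 hd2)).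
have pv : ball p r (p + h *: v) by apply: vr; rewrite ger0_norm// ltW.
have pNv : ball p r (p + h *: - v) by apply: (in_ballN vr); rewrite ger0_norm// ltW.
have := slope_opp h0 h0 pv pNv; rewrite -mulrDr pmulr_rge0// => H.
have := le_trans H (lerD h1 h2); rewrite -mulrDl pmulr_lge0//; lra.
Qed.

Let E i : 'rV[R]_n := delta_mx ord0 i.

Lemma in_ball_axis i : in_ball (E i).
Proof. by move=> h hr; exact: ball_axis. Qed.

Lemma axis_near i b e : slope (E i) = b -> slope (- E i) = - b -> 0 < e ->
  \forall t \near (0 : R), G (p + t *: E i) - G p <= b * t + e * `|t|.
Proof.
move=> sb sNb e0; have [d [d0 hd]] := slope_near (@in_ball_axis i) e0.
have [d' [d'0 hd']] := slope_near (in_ballN (@in_ball_axis i)) e0.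
have m0 : 0 < Num.min d d' by rewrite lt_min d0 d'0.
apply/nbhs_ballP; exists (Num.min d d') => //= t.
rewrite /ball/= sub0r normrN lt_min => /andP[td td'].
have [t0|t0|->] := ltgtP t 0.
- have := hd' (- t); rewrite oppr_gt0 t0/= -(ltr0_norm t0) => /(_ td').
  by rewrite sNb scalerN (ltr0_norm t0) scaleNr opprK => /le_trans; apply; lra.
- have := hd t; rewrite t0/= -{1}(gtr0_norm t0) => /(_ td).
  by rewrite sb (gtr0_norm t0) => /le_trans; apply; lra.
- by rewrite scale0r addr0 subrr normr0 !mulr0 addr0.
Qed.

Lemma ball_convex (t : R) x y : 0 <= t <= 1 -> ball p r x -> ball p r y ->
  ball p r (t *: x + (1 - t) *: y).
Proof.
move=> /andP[t0 t1]; rewrite -ball_normE /ball_/= => px py.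
have -> : p - (t *: x + (1 - t) *: y) = t *: (p - x) + (1 - t) *: (p - y).
  by rewrite !scalerBr addrACA -scalerDl [t + _]addrC subrK scale1r opprD.
rewrite (le_lt_trans (ler_normD _ _))// !normrZ ger0_norm// ger0_norm ?subr_ge0//.
have [->|tn1] := eqVneq t 1; first by rewrite subrr mul0r addr0 mul1r.
have t1' : 0 < 1 - t by rewrite subr_gt0 lt_neqAle tn1.
have : (1 - t) * `|p - y| < (1 - t) * r by rewrite ltr_pM2l.
have : t * `|p - x| <= t * r by rewrite ler_wpM2l// ltW.
lra.
Qed.

Lemma jensen (s : seq 'rV[R]_n) : s != [::] -> (forall x, x \in s -> ball p r x) ->
  ball p r ((size s)%:R^-1 *: \sum_(x <- s) x) /\
  G ((size s)%:R^-1 *: \sum_(x <- s) x) <= (size s)%:R^-1 * \sum_(x <- s) G x.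
Proof.
elim: s => // x s IH _ xs; rewrite !big_cons /=.
have px : ball p r x by apply: xs; rewrite mem_head.
have [->|sn] := eqVneq s [::]; first by rewrite !big_nil invr1 !addr0 scale1r mul1r.
have [//|y ys|ps Gs] := IH; first by apply: xs; rewrite inE ys orbT.
set k := size s in ps Gs *; set S := \sum_(_ <- _) _ in ps Gs *.
have k0 : k%:R != 0 :> R by rewrite pnatr_eq0 /k; case: (s) sn.
have k1 : k.+1%:R != 0 :> R by rewrite pnatr_eq0.
have kE : k.+1%:R = k%:R + 1 :> R by rewrite -natr1.
have l01 : 0 <= (k.+1%:R^-1 : R) <= 1.
  apply/andP; split; first by rewrite invr_ge0 ler0n.
  by rewrite invf_le1 ?ltr0n// ler1n.
have lE : 1 - k.+1%:R^-1 = k.+1%:R^-1 * k%:R :> R.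
  by apply: (mulfI k1); rewrite mulrBr mulr1 mulrA mulfV// mul1r kE addrK.
have -> : k.+1%:R^-1 *: (x + S) = k.+1%:R^-1 *: x + (1 - k.+1%:R^-1) *: (k%:R^-1 *: S).
  by rewrite scalerDr scalerA lE mulfK.
split; first exact: ball_convex.
rewrite (le_trans (cG l01 px ps))// mulrDr lerD2l lE.
rewrite -mulrA ler_wpM2l ?invr_ge0//.
have kp : 0 < (k%:R : R) by rewrite lt_def k0 ler0n.
by rewrite -ler_pdivlMl.
Qed.

End ConvexAt.

(** * Differentiability from slopes along the axes *)

Section Differentiability.
Context (R : realType) (n : nat).
Implicit Types (p v h : 'rV[R]_n).

Let E i : 'rV[R]_n := delta_mx ord0 i.

Definition lin_form (d : 'I_n -> R) (v : 'rV[R]_n) : R := \sum_i d i * v ord0 i.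

Lemma lin_form_is_linear d : linear (lin_form d).
Proof.
move=> a u v; rewrite /lin_form scaler_sumr -big_split/=; apply: eq_bigr => i _.
by rewrite !mxE mulrDr mulrCA.
Qed.

HB.instance Definition _ d := GRing.isLinear.Build R 'rV[R]_n R _ (lin_form d)
  (lin_form_is_linear d).

Lemma coord_le_norm v i : `|v ord0 i| <= `|v|.
Proof.
rewrite [leRHS]mx_normrE.
by apply: (@le_bigmax _ _ _ 0 (fun ij : 'I_1 * 'I_n => `|v ij.1 ij.2|) (ord0, i)).
Qed.

Lemma sum_coord_le_norm v : \sum_i `|v ord0 i| <= n%:R * `|v|.
Proof.
apply: (le_trans (ler_sum _ (fun i _ => coord_le_norm v i))).
by rewrite sumr_const card_ord mulr_natl.
Qed.

Lemma lin_form_continuous d : continuous (lin_form d : 'rV[R]_n -> R).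
Proof.
move=> v; rewrite /continuous_at /lin_form.
apply: (cvg_big _ (F := nbhs v)) => [|i _]; first exact: add_continuous.
by apply: cvgM; [exact: cvg_cst|exact: coord_continuous].
Qed.

Lemma sqnormD p h : sqnorm (p + h) = sqnorm p + 2 * lin_form (p ord0) h + sqnorm h.
Proof.
rewrite /sqnorm /lin_form mulr_sumr -!big_split/=; apply: eq_bigr => i _.
rewrite mxE; ring.
Qed.

Lemma sqnorm_axis (t : R) i : sqnorm (t *: E i) = t ^+ 2.
Proof.
rewrite /sqnorm (bigD1 i)//= big1 => [|j ji]; first by rewrite !mxE !eqxx mulr1 addr0.
by rewrite !mxE eqxx (negbTE ji) mulr0 expr0n.
Qed.

Lemma lin_form_axis d (t : R) i : lin_form d (t *: E i) = d i * t.
Proof.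
rewrite /lin_form (bigD1 i)//= big1 => [|j ji]; first by rewrite !mxE !eqxx mulr1 addr0.
by rewrite !mxE eqxx (negbTE ji) !mulr0.
Qed.

Lemma sqnorm_le v : sqnorm v <= n%:R * `|v| ^+ 2.
Proof.
apply: (@le_trans _ _ (\sum_(i < n) `|v| ^+ 2)).
  apply: ler_sum => i _; rewrite -real_normK ?num_real//.
  by rewrite ler_sqr ?nnegrE//; exact: coord_le_norm.
by rewrite sumr_const card_ord mulr_natl.
Qed.

Lemma sqnorm_ge0 v : 0 <= sqnorm v.
Proof. by apply: sumr_ge0 => i _; exact: sqr_ge0. Qed.

(** p + h is the average of the n points p + n h_i E_i, so Jensen's inequality reduces the bound to
    the axes. The axis errors (e/n) n |h_i| average to (e/n) times the sum of the |h_i|, at most e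
    |h|. *)
Lemma convex_upper (G : 'rV[R]_n -> R) p r (b : 'I_n -> R) e :
  0 < r -> convex_near G p r ->
  (forall i, slope G p r (E i) = b i) -> (forall i, slope G p r (- E i) = - b i) ->
  0 < e -> \forall h \near (0 : 'rV[R]_n), G (p + h) - G p <= lin_form b h + e * `|h|.
Proof.
move=> r0 cG sb sNb e0.
have [n0|n0] := posnP n.
  apply/nbhs_ballP; exists 1 => //= h _; have -> : h = 0.
    by apply/rowP => i; have := ltn_ord i; rewrite [X in (_ < X)%N]n0.
  by rewrite addr0 subrr linear0 normr0 mulr0 addr0.
have nR : 0 < (n%:R : R) by rewrite ltr0n.
have en : 0 < e / n%:R by rewrite divr_gt0.
have : \forall t \near (0 : R), forall i,
    G (p + t *: E i) - G p <= b i * t + e / n%:R * `|t|.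
  apply: (@filter_forall R _ (fun i t => G (p + t *: E i) - G p <= b i * t + e / n%:R * `|t|)
    (nbhs (0 : R)) _) => i.
  exact: (axis_near r0 cG (sb i) (sNb i) en).
move=> /nbhs_ballP[s /= s0 hs].
have m0 : 0 < Num.min s r / n%:R by rewrite divr_gt0// lt_min s0 r0.
apply/nbhs_ballP; exists (Num.min s r / n%:R) => //= h.
rewrite -ball_normE /ball_/= sub0r normrN ltr_pdivlMr// lt_min => /andP[hs' hr].
have coord i : `|n%:R * h ord0 i| <= `|h| * n%:R.
  by rewrite normrM (ger0_norm (ltW nR)) mulrC ler_pM2r// coord_le_norm.
pose x i := p + (n%:R * h ord0 i) *: E i.
have sE : size [seq x i | i <- enum 'I_n] = n by rewrite size_map size_enum_ord.
have [||_] := jensen cG (s := [seq x i | i <- enum 'I_n]).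
- by rewrite -size_eq0 sE -lt0n.
- move=> _ /mapP[i _ ->]; apply: ball_axis => //; exact: le_lt_trans (coord i) hr.
rewrite sE !big_map -!enumT !big_enum /=.
have -> : n%:R^-1 *: \sum_i x i = p + h.
  rewrite /x big_split/= sumr_const card_ord scalerDr -[p *+ n]scaler_nat scalerA mulVf ?gt_eqF//.
  rewrite scale1r scaler_sumr; congr (_ + _).
  under eq_bigr => i _ do rewrite scalerA mulrA mulVf ?gt_eqF// mul1r.
  by rewrite -row_sum_delta.
move=> H.
have H2 : \sum_i G (x i) <= \sum_i (G p +
    (b i * (n%:R * h ord0 i) + e / n%:R * (n%:R * `|h ord0 i|))).
  apply: ler_sum => i _; rewrite -lerBlDl.
  have bt : ball 0 s (n%:R * h ord0 i).
    by rewrite /ball/= sub0r normrN; exact: le_lt_trans (coord i) hs'.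
  by have := hs _ bt i; rewrite normrM (ger0_norm (ltW nR)).
have nV0 : 0 <= (n%:R^-1 : R) by rewrite invr_ge0 ltW.
rewrite lerBlDl (le_trans H)// (le_trans (ler_wpM2l nV0 H2))//.
rewrite big_split/= sumr_const card_ord mulrDr -[G p *+ n]mulr_natl mulrA mulVf ?gt_eqF// mul1r.
rewrite lerD2l big_split/= mulrDr.
apply: lerD.
  rewrite le_eqVlt; apply/orP; left; apply/eqP; rewrite /lin_form mulr_sumr.
  by apply: eq_bigr => i _; rewrite mulrCA mulKf ?gt_eqF.
rewrite -mulr_sumr mulrA [_^-1 * _]mulrC -mulrA.
rewrite -mulr_sumr mulKf ?gt_eqF// -mulrA ler_pM2l// mulrC ler_pdivrMr// mulrC.
exact: sum_coord_le_norm.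
Qed.

(** The upper bound at - h, combined with 2 G p <= G (p + h) + G (p - h). *)
Lemma convex_lower (G : 'rV[R]_n -> R) p r (b : 'I_n -> R) e :
  0 < r -> convex_near G p r ->
  (forall i, slope G p r (E i) = b i) -> (forall i, slope G p r (- E i) = - b i) ->
  0 < e -> \forall h \near (0 : 'rV[R]_n), lin_form b h - e * `|h| <= G (p + h) - G p.
Proof.
move=> r0 cG sb sNb e0.
have /nbhs_ballP[s /= s0 hs] := convex_upper r0 cG sb sNb e0.
have m0 : 0 < Num.min s r by rewrite lt_min s0 r0.
apply/nbhs_ballP; exists (Num.min s r) => //= h.
rewrite -ball_normE /ball_/= sub0r normrN lt_min => /andP[hs' hr].
have pN (v : 'rV[R]_n) : `|v| < r -> ball p r (p + 1 *: v).
  by rewrite -ball_normE /ball_/= scale1r opprD addrA subrr sub0r normrN.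
have hN : ball (0 : 'rV[R]_n) s (- h).
  by rewrite -ball_normE /ball_/= sub0r !normrN.
have hrN : `|- h| < r by rewrite normrN.
have := slope_opp cG ltr01 ltr01 (pN _ hr) (pN _ hrN).
have := hs _ hN; rewrite /= linearN normrN !mul1r !scale1r; lra.
Qed.

Lemma differentiable_lin_form (f : 'rV[R]_n -> R) p d :
  (forall e, 0 < e -> \forall h \near (0 : 'rV[R]_n),
     `|f (p + h) - f p - lin_form d h| <= e * `|h|) ->
  differentiable f p /\ 'd f p = lin_form d :> ('rV[R]_n -> R).
Proof.
move=> fd.
have H : f \o shift p = cst (f p) + lin_form d +o_ (0 : 'rV[R]_n) id.
  apply/eqaddoP => e e0; have /nbhs_ballP[s s0 hs] := fd e e0.
  apply/nbhs_ballP; exists s => // h /hs /=.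
  by rewrite !fctE /= [p + h]addrC opprD addrA.
have dE : 'd f p = lin_form d :> ('rV[R]_n -> R).
  by apply: diff_unique; [exact: lin_form_continuous|exact: H].
split => //; apply/diff_locallyP; rewrite dE; split; last exact: H.
exact: lin_form_continuous.
Qed.

Lemma semiconcave_differentiable (f : 'rV[R]_n -> R) p (K r : R) (b : 'I_n -> R) :
  0 < r -> convex_near (fun v => K * sqnorm v - f v) p r ->
  (forall i, slope (fun v => K * sqnorm v - f v) p r (E i) = b i) ->
  (forall i, slope (fun v => K * sqnorm v - f v) p r (- E i) = - b i) ->
  differentiable f p /\
  'd f p = lin_form (fun i => 2 * K * p ord0 i - b i) :> ('rV[R]_n -> R).
Proof.
move=> r0 cG sb sNb; apply: differentiable_lin_form => e e0.
have e2 : 0 < e / 2 by rewrite divr_gt0.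
have U := convex_upper r0 cG sb sNb e2.
have L := convex_lower r0 cG sb sNb e2.
have C0 : 0 < `|K| * n%:R + 1 by rewrite ltr_wpDl// mulr_ge0.
have S : \forall h \near (0 : 'rV[R]_n), `|K * sqnorm h| <= e / 2 * `|h|.
  (* The factor n compares [sqnorm] with the square of the sup norm; the 1 keeps the denominator
     positive. *)
  apply/nbhs_ballP; exists (e / 2 / (`|K| * n%:R + 1)) => /=; first by rewrite divr_gt0.
  move=> h; rewrite -ball_normE /ball_/= sub0r normrN ltr_pdivlMr// => hh.
  rewrite normrM (ger0_norm (sqnorm_ge0 h)).
  apply: (@le_trans _ _ (`|K| * (n%:R * `|h| ^+ 2))).
    by rewrite ler_wpM2l// sqnorm_le.
  rewrite expr2 !mulrA ler_wpM2r//; apply: le_trans (ltW hh).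
  by rewrite mulrC ler_wpM2l// lerDl.
near=> h.
have u : K * sqnorm (p + h) - f (p + h) - (K * sqnorm p - f p) <=
  lin_form b h + e / 2 * `|h| by near: h.
have l : lin_form b h - e / 2 * `|h| <=
  K * sqnorm (p + h) - f (p + h) - (K * sqnorm p - f p) by near: h.
have s : `|K * sqnorm h| <= e / 2 * `|h| by near: h.
have -> : lin_form (fun i => 2 * K * p ord0 i - b i) h =
    2 * K * lin_form (p ord0) h - lin_form b h.
  rewrite /lin_form mulr_sumr -sumrB; apply: eq_bigr => i _; ring.
move: u l s; rewrite sqnormD !ler_norml.
set x := lin_form _ _; set y := lin_form _ _; set z := f (p + h).
set w := sqnorm h; set q := sqnorm p; set k := `|h|.
by move=> u l /andP[s1 s2]; apply/andP; split; lra.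
Unshelve. all: by end_near. Qed.

(* Slopes of semiconcave functions touching phi from above at p: unless the
   left slope is at most the right slope, phi has a kink at p. *)
Lemma touch_slopes (phi f g : 'rV[R]_n -> R) (O : set 'rV[R]_n) p (K r K' r' : R) i :
  0 < r -> convex_near (fun v => K * sqnorm v - f v) p r ->
  0 < r' -> convex_near (fun v => K' * sqnorm v - g v) p r' ->
  nbhs p O ->
  (forall q, O q -> phi q - phi p <= f q - f p) ->
  (forall q, O q -> phi q - phi p <= g q - g p) ->
  (forall (a b : rat) k, (ratr a : R) < ratr b ->
     ~ kink phi O i (ratr a) (ratr b) k.+1%:R^-1 p) ->
  2 * K' * p ord0 i + slope (fun v => K' * sqnorm v - g v) p r' (- E i) <=
  2 * K * p ord0 i - slope (fun v => K * sqnorm v - f v) p r (E i).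
Proof.
move=> r0 cf r'0 cg pO phif phig nk; rewrite leNgt; apply/negP => AB.
set F := fun v => _ in AB; set G := (X in slope X p r' _) in AB.
set A := _ - _ in AB; set B := _ + _ in AB.
(* A is the right slope of f and B the left slope of g along the axis; the rationals satisfy A < a <
   b < B. *)
have [b] := rat_in_itvoo AB; rewrite in_itv/= => /andP[Ab bB].
have [a] := rat_in_itvoo Ab; rewrite in_itv/= => /andP[Aa ab].
have /nbhs_ballP[s /= s0 sO] := pO.
have K1 : 0 < `|K| + 1 by rewrite ltr_wpDl.
have K'1 : 0 < `|K'| + 1 by rewrite ltr_wpDl.
(* Below these scales the quadratic terms K h and K' h fit into the margins a - A and B - b. *)
pose t1 := (ratr a - A) / (`|K| + 1); pose t2 := (B - ratr b) / (`|K'| + 1).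
have m0 : 0 < Num.min (Num.min t1 t2) (Num.min s (Num.min r r')).
  by rewrite !lt_min r0 r'0 s0 /t1 /t2 !divr_gt0// subr_gt0.
have [k kt] := filter_ex (near_infty_natSinv_lt (PosNum m0)).
apply: (nk a b k ab).
have [d dE] : exists d : R, d = k.+1%:R^-1 by exists k.+1%:R^-1.
have d0 : 0 < d by rewrite dE invr_gt0 ltr0n.
rewrite /= -dE in kt; rewrite -dE.
move: kt; rewrite !lt_min => /and3P[/andP[dt1 dt2] ds /andP[dr dr']].
split.
  move=> q pq; apply: sO; exact: le_ball (ltW ds) _ pq.
move=> h /andP[h0 hd].
have hs : `|h| < s by rewrite gtr0_norm// (lt_trans hd).
have hr : 0 < h < r by rewrite h0 (lt_trans hd).
have hr' : 0 < h < r' by rewrite h0 (lt_trans hd).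
have sqE (t : R) : sqnorm (p + t *: E i) = sqnorm p + 2 * (p ord0 i * t) + t ^+ 2.
  by rewrite sqnormD lin_form_axis sqnorm_axis.
have Kh : K * h <= ratr a - A.
  apply: (@le_trans _ _ (`|K| * h)); first by rewrite ler_wpM2r ?ler_norm// ltW.
  move: (ltW (lt_trans hd dt1)); rewrite /t1 ler_pdivlMr//; lra.
have K'h : K' * h <= B - ratr b.
  apply: (@le_trans _ _ (`|K'| * h)); first by rewrite ler_wpM2r ?ler_norm// ltW.
  move: (ltW (lt_trans hd dt2)); rewrite /t2 ler_pdivlMr//; lra.
have ball_in : forall r, 0 < r -> in_ball p r (E i).
  by move=> r1 r10 t; exact: ball_axis.
split.
  have := phif _ (sO _ (ball_axis p i s0 hs)).
  have := slope_lb r0 cf (ball_in _ r0) hr.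
  have := ler_wpM2r (ltW h0) Kh.
  rewrite -/F sqE /A; set S := slope _ _ _ _.
  set x := f (p + _); set y := phi (p + _); set z := p ord0 i.
  lra.
have hNs : `|- h| < s by rewrite normrN.
have := phig _ (sO _ (ball_axis p i s0 hNs)).
have := slope_lb r'0 cg (in_ballN (ball_in _ r'0)) hr'.
have := ler_wpM2r (ltW h0) K'h.
rewrite -/G scalerN -scaleNr sqE /B; set S := slope _ _ _ _.
set x := g (p + _); set y := phi (p + _); set z := p ord0 i.
lra.
Qed.

End Differentiability.

Section Touch.
Context (R : realType) (n : nat).
Variables (phi f g : 'rV[R]_n -> R) (O : set 'rV[R]_n) (p : 'rV[R]_n) (K r K' r' : R).
Hypotheses (r0 : 0 < r) (cf : convex_near (fun v => K * sqnorm v - f v) p r)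
  (r'0 : 0 < r') (cg : convex_near (fun v => K' * sqnorm v - g v) p r')
  (pO : nbhs p O)
  (phif : forall q, O q -> phi q - phi p <= f q - f p)
  (phig : forall q, O q -> phi q - phi p <= g q - g p)
  (nk : forall i (a b : rat) k, (ratr a : R) < ratr b ->
     ~ kink phi O i (ratr a) (ratr b) k.+1%:R^-1 p).

(** Without kinks, left slopes are at most right slopes, for each of f and g and across the two;
    semiconcavity gives the reverse for each. So all four slopes along an axis agree. *)
Lemma touch_differentiable :
  [/\ differentiable f p, differentiable g p & 'd f p = 'd g p :> ('rV[R]_n -> R)].
Proof.
pose F v := K * sqnorm v - f v; pose G v := K' * sqnorm v - g v.
pose E i : 'rV[R]_n := delta_mx ord0 i.
have fN i : slope F p r (- E i) = - slope F p r (E i).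
  have h1 := slope_opp_ge0 r0 cf (@in_ball_axis _ _ p _ r0 i).
  have h2 := touch_slopes r0 cf r0 cf pO phif phif (@nk i).
  by apply/eqP; rewrite eq_le; apply/andP; split; rewrite /F /E; lra.
have gN i : slope G p r' (- E i) = - slope G p r' (E i).
  have h1 := slope_opp_ge0 r'0 cg (@in_ball_axis _ _ p _ r'0 i).
  have h2 := touch_slopes r'0 cg r'0 cg pO phig phig (@nk i).
  by apply/eqP; rewrite eq_le; apply/andP; split; rewrite /G /E; lra.
have [df dfE] := semiconcave_differentiable r0 cf (fun i => erefl) fN.
have [dg dgE] := semiconcave_differentiable r'0 cg (fun i => erefl) gN.
split => //; rewrite dfE dgE; congr lin_form; apply/funext => i.
have h1 := touch_slopes r0 cf r'0 cg pO phif phig (@nk i).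
have h2 := touch_slopes r'0 cg r0 cf pO phig phif (@nk i).
have := fN i; have := gN i; rewrite /F /G /E => e1 e2; rewrite e1 in h1; rewrite e2 in h2.
by apply/eqP; rewrite eq_le; apply/andP; split; lra.
Qed.

End Touch.

(** * Semiconcavity of the slices in the first variable *)

Section Slice.
Context (R : realType) (m : nat) (M : 'I_m.+1 -> smoothManifold R).
Implicit Types (c : mprod M -> R).

Lemma sqnorm_mxrow (k : nat) (d : 'I_k -> nat) (B : forall i, 'rV[R]_(d i)) :
  sqnorm (\mxrow_i B i) = \sum_i sqnorm (B i).
Proof.
have sqE l (v : 'rV[R]_l) : sqnorm v = (v *m v^T) ord0 ord0.
  by rewrite mxE; apply: eq_bigr => i _; rewrite mxE expr2.
rewrite sqE tr_mxrow mul_mxrow_mxcol summxE.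
by apply: eq_bigr => i _; rewrite sqE.
Qed.

(** With the other chart coordinates frozen, the squared norm splits into that of v and a
    constant. *)
Lemma semiconcave_slice c (x : mprod M) (e : chart R (manifold_dim (M ord0)) (M ord0)) :
  semiconcave c -> atlas e -> chart_dom e (x ord0) ->
  exists K r, 0 < r /\
    convex_near (fun v => K * sqnorm v - slice1 c e x v) (e (x ord0)) r.
Proof.
move=> sc ae ex.
pose e' i := if pselect (i = ord0) is left h then
    ecast j (chart R (manifold_dim (M j)) (M j)) (esym h) e
  else s2val (cid2 (atlas_cover (x i))).
have e'0 : e' ord0 = e.
  by rewrite /e'; case: pselect => // h; rewrite (eq_irrelevance (esym h) erefl).
have e'x i : atlas (e' i) /\ chart_dom (e' i) (x i).
  have [->|i0] := eqVneq i ord0; first by rewrite e'0.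
  rewrite /e'; case: pselect => [h|_]; first by rewrite h eqxx in i0.
  by case: cid2.
have [K [r [r0 /convex_function_near cv]]] := sc x e' e'x.
exists K, r; split => //.
pose V (v : 'rV[R]_(manifold_dim (M ord0))) i : 'rV[R]_(manifold_dim (M i)) :=
  @dfwith 'I_m.+1 (fun i => 'rV[R]_(manifold_dim (M i))) (fun i => e' i (x i)) ord0 v i.
have Vx : \mxrow_i e' i (x i) = \mxrow_i V (e (x ord0)) i.
  congr mxrow; apply/functional_extensionality_dep => i; rewrite /V.
  by have [->|i0] := eqVneq i ord0; [rewrite dfwithin e'0|rewrite dfwithout 1?eq_sym].
have VE v : K * sqnorm (\mxrow_i V v i) - in_charts c e' (\mxrow_i V v i) =
   K * sqnorm v - slice1 c e x v + K * \sum_(i | i != ord0) sqnorm (e' i (x i)).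
  rewrite sqnorm_mxrow (bigD1 ord0)//= /V dfwithin.
  under eq_bigr => i i0 do rewrite dfwithout 1?eq_sym//.
  have -> : in_charts c e' (\mxrow_i V v i) = slice1 c e x v; last by rewrite /V; lra.
  congr (c _); apply/functional_extensionality_dep => i; rewrite mxrowK /V.
  have [->|i0] := eqVneq i ord0; first by rewrite !dfwithin e'0.
  by rewrite !dfwithout 1?eq_sym// chart_mapE//; have [] := e'x i.
have Vball v : ball (e (x ord0)) r v -> ball (\mxrow_i e' i (x i)) r (\mxrow_i V v i).
  move=> [_ hv]; split => // i j; rewrite (ord1 i) Vx !mxE; rewrite /V.
  move: (tagnat.sig1 j) (tagnat.sig2 j) => {}i k.
  have [i0|i0] := eqVneq i ord0; last by rewrite !dfwithout 1?eq_sym//; exact: ballxx.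
  by move: k; rewrite i0 => k; rewrite !dfwithin.
move=> t v w t01 pv pw.
have := cv t _ _ t01 (Vball _ pv) (Vball _ pw).
have -> : t *: (\mxrow_i V v i) + (1 - t) *: (\mxrow_i V w i) =
    \mxrow_i V (t *: v + (1 - t) *: w) i.
  apply/rowP => j; rewrite !mxE /V.
  move: (tagnat.sig1 j) (tagnat.sig2 j) => i k.
  have [i0|i0] := eqVneq i ord0; last first.
    by rewrite !dfwithout 1?eq_sym// -mulrDl [t + _]addrC subrK mul1r.
  by move: k; rewrite i0 => k; rewrite !dfwithin !mxE.
by rewrite !VE; set C := K * \sum_(_ | _) _; lra.
Qed.

End Slice.

(** * Optimal plans *)

Lemma measure_bigcup_countType d (T : measurableType d) (R : realType)
    (mu : {measure set T -> \bar R}) (I : countType) (F : I -> set T) :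
  (forall i, measurable (F i)) -> (forall i, mu (F i) = 0%E) ->
  mu (\bigcup_i F i) = 0%E.
Proof.
move=> mF F0; pose F' n := if choice.unpickle n is Some i then F i else set0.
have mF' n : measurable (F' n) by rewrite /F'; case: choice.unpickle.
apply/eqP; rewrite -measure_le0.
have -> : \bigcup_i F i = \bigcup_n F' n.
  apply/seteqP; split => x.
    by move=> [i _ Fx]; exists (choice.pickle i) => //; rewrite /F' choice.pickleK.
  by move=> [n _]; rewrite /F'; case: choice.unpickle => // i Fx; exists i.
apply: le_trans (measure_sigma_subadditive _ _ _ _) _ => //.
  exact: bigcup_measurable.
rewrite eseries0// => n _ _; rewrite /F'.
by case: choice.unpickle => // [i|]; rewrite ?F0 ?measure0.
Qed.

Section Coupling.
Context (R : realType) (m : nat) (M : 'I_m.+1 -> smoothManifold R)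
  (mu : forall i, probability (borel (M i)) R).
Hypothesis mu_compact : forall i, compactly_supported (mu i).

Let K : set (borel (mprod M)) := spts mu.

Variable g : probability (borel (mprod M)) R.
Hypothesis g_coupling : coupling mu g.

Lemma proj_measurable i :
  measurable_fun setT (fun x : borel (mprod M) => (x : mprod M) i : borel (M i)).
Proof. by apply: continuous_measurable_borel; exact: mprod_proj_continuous. Qed.

Lemma coupling_spts : g (~` K) = 0%E.
Proof.
have -> : ~` K = \bigcup_i ((fun x : mprod M => x i) @^-1` (~` @spt _ _ _ mu i)).
  apply/seteqP; split => x; last by move=> [i _ h] /(_ i).
  by move=> /existsNP[i h]; exists i.
apply: measure_bigcup_countType => i.
  rewrite -[X in measurable X]setTI; apply: proj_measurable => //.
  by apply: measurableC; exact: spt_measurable.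
apply: etrans (@spt_full _ _ _ mu i); apply: g_coupling; apply: measurableC.
exact: spt_measurable.
Qed.

Lemma mean_proj i (u : borel (M i) -> R) : bmeas mu u ->
  mean g K (fun x => u ((x : mprod M) i)) = integ mu u.
Proof.
move=> [mu' [B uB]].
(* u is bounded on the support only; cut off there, it is integrable on the whole space and has the
   same mean. *)
pose v : borel (M i) -> R := fun x => u x * \1_(@spt _ _ _ mu i) x.
have mv : measurable_fun setT v.
  by apply: measurable_funM => //; apply: measurable_indic; exact: spt_measurable.
have vB x : `|v x| <= `|B|.
  rewrite /v normrM indicE; case: (boolP (x \in _)) => [/set_mem/uB h|_].
    by rewrite normr1 mulr1 (le_trans h)// ler_norm.
  by rewrite normr0 mulr0.
have vE x : spt mu x -> u x = v x.
  by move=> Kx; rewrite /v indicE mem_set// mulr1.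
have bv : bmeas mu v by split => //; exists `|B|.
have bvp : bounded_measurable K (fun x : borel (mprod M) => v ((x : mprod M) i)).
  split; last by exists `|B|.
  exact: (measurableT_comp mv (@proj_measurable i)).
rewrite (@eq_mean _ _ _ g K _ (fun x : borel (mprod M) => v ((x : mprod M) i))); last first.
  by move=> x Kx; apply: vE; exact: Kx.
rewrite /integ (@eq_mean _ _ _ (mu i) _ u v)//.
apply: EFin_inj; rewrite (EFin_mean (spts_measurable mu_compact) coupling_spts)//.
rewrite (EFin_mean (@spt_measurable _ _ _ mu i) (@spt_full _ _ _ mu i))//.
transitivity (\int[pushforward g (fun x : borel (mprod M) => (x : mprod M) i : borel (M i))]_x
  (v x)%:E)%E; last first.
  apply: eq_measure_integral => [|mT A mA _]; first exact: proj_measurable.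
  exact: (g_coupling mA).
rewrite integral_pushforward//; first exact: proj_measurable.
- exact/measurable_EFinP.
- rewrite preimage_setT; apply: measurable_bounded_integrable => //.
  + by rewrite (le_lt_trans (probability_le1 _ _))// ltry.
  + exact: (measurableT_comp mv (@proj_measurable i)).
  + exists `|B|; split; first exact: num_real.
    by move=> x Bx y _ /=; apply: le_trans (vB _) (ltW Bx).
Qed.

End Coupling.

Section Optimality.
Context (R : realType) (m : nat) (M : 'I_m.+1 -> smoothManifold R)
  (mu : forall i, probability (borel (M i)) R).
Hypothesis mu_compact : forall i, compactly_supported (mu i).
Context (c : mprod M -> R).
Hypothesis c_continuous : continuous c.

Let K : set (borel (mprod M)) := spts mu.

Lemma cost_mean (g : probability (borel (mprod M)) R) : coupling mu g ->
  (\int[g]_x (c x)%:E)%E = (mean g K c)%:E.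
Proof.
move=> hg; rewrite (EFin_mean (spts_measurable mu_compact) (coupling_spts hg))//.
exact: bounded_measurable_continuous.
Qed.

Lemma value_mean (g : probability (borel (mprod M)) R) (v : family M) :
  coupling mu g -> minorant mu c v ->
  bounded_measurable K (fun x : borel (mprod M) => \sum_i v i ((x : mprod M) i)) /\
  mean g K (fun x : borel (mprod M) => \sum_i v i ((x : mprod M) i)) = value mu v.
Proof.
move=> hg [hv _].
have hvp i : bounded_measurable K (fun x : borel (mprod M) => v i ((x : mprod M) i)).
  have [mv [B vB]] := hv i; split; first exact: (measurableT_comp mv (@proj_measurable _ _ _ i)).
  by exists B => x Kx; apply: vB; exact: Kx.
split; first exact: (bounded_measurable_sum _ hvp).
rewrite (mean_sum (spts_measurable mu_compact) (coupling_spts hg) _ hvp).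
by apply: eq_bigr => i _; exact: mean_proj.
Qed.

Lemma weak_duality (g : probability (borel (mprod M)) R) (v : family M) :
  coupling mu g -> minorant mu c v -> value mu v <= mean g K c.
Proof.
move=> hg hv; have [bv <-] := value_mean hg hv.
apply: le_mean => //; first exact: spts_measurable.
  exact: bounded_measurable_continuous.
by move=> x Kx; exact: hv.2.
Qed.

(** Hahn-Banach at [- c] gives L c = [- dual mu (- c)], and L c is the cost of the plan because c is
    continuous. *)
Lemma plan_exists : exists g : probability (borel (mprod M)) R,
  coupling mu g /\ mean g K c = - dual mu (- c).
Proof.
have [L [L_le LNc LD LZ]] := hahn_banach_dominated (bounded_spts_cst mu 0)
  (@bounded_sptsD _ _ _ mu) (@bounded_sptsZ _ _ _ mu) (dual_sublinear mu)
  (bounded_sptsN_cost mu_compact c_continuous).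
pose lam := plan_charge mu_compact L_le LD LZ.
have [g gE] := radon_charge_extension (plan_chargeT mu_compact L_le LD LZ)
  (@open_sigma_approximable _ _ _ _ mu_compact _ L_le LD LZ).
exists g; split; first exact: (plan_coupling gE).
have bc := bounded_measurable_continuous mu_compact c_continuous.
rewrite -(exact_continuous gE c_continuous) -LNc.
have := LZ (-1) c (bounded_measurable_bnd bc).
by rewrite scaleN1r mulN1r => ->; rewrite opprK.
Qed.

End Optimality.

(** * Kinks on a manifold form a null set *)

Section KinkNull.
Context (R : realType) (M : smoothManifold R).

(** A Lindelof argument: one chart is kept for each basic open set that some chart domain contains,
    and an arbitrary one for the other basic sets. *)
Lemma countable_atlas : exists e : nat -> chart R (manifold_dim M) M,
  (forall n, atlas (e n)) /\ forall x, exists n, chart_dom (e n) x.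
Proof.
have [b [_ bb]] := second_countable_seq (@manifold_second_countable _ M).
have /choice[e eb] n : exists e : chart R (manifold_dim M) M, atlas e /\
    forall e', atlas e' -> b n `<=` chart_dom e' -> b n `<=` chart_dom e.
  have [[e [ae be]]|ne] := pselect (exists e : chart R (manifold_dim M) M,
      atlas e /\ b n `<=` chart_dom e); first by exists e.
  by have [e ae _] := atlas_cover (point : M); exists e; split => // e' ae' /(conj ae') h;
    case: ne; exists e'.
exists e; split => [n|x]; first exact: (eb n).1.
have [e' ae' e'x] := atlas_cover x.
have [n bx be'] := bb x _ (chart_dom_open_nbhs e'x).
by exists n; exact: (eb n).2 ae' be' x bx.
Qed.

(** Continuity of e is given on its domain only, so the set is written as a difference of two open
    sets. *)
Lemma chart_preimage_measurable (e : chart R (manifold_dim M) M) (C : set 'rV[R]_(manifold_dim M)) :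
  closed C -> measurable (chart_dom e `&` e @^-1` C : set (borel M)).
Proof.
move=> cC; have -> : chart_dom e `&` e @^-1` C = chart_dom e `\` (chart_dom e `&` e @^-1` (~` C)).
  apply/seteqP; split => x [ex] /=; first by move=> Cx; split => // -[].
  by move=> h; split => //; apply: contrapT => nC; exact: h.
apply: measurableD; apply: open_borel; first exact: chart_dom_open.
rewrite openE => x [ex nC]; apply: filterI; first exact: chart_dom_open_nbhs.
by apply: chart_map_nbhs => //; apply: open_nbhs_nbhs; split => //; exact: closed_openC.
Qed.

Lemma kinks_null (mu : probability (borel M) R) (u : M -> R) :
  ac_in_charts mu -> continuous u ->
  exists N : set (borel M), [/\ measurable N, mu N = 0%E & forall x, ~ N x ->
    exists e, [/\ atlas e, chart_dom e x & forall i (a b : rat) k, ratr a < ratr b :> R ->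
      ~ kink (u \o chart_inv e) (chart_cod e) i (ratr a) (ratr b) k.+1%:R^-1 (e x)]].
Proof.
move=> ac cu; have [e [ae ex]] := countable_atlas.
pose C n i (a b : rat) k : set 'rV[R]_(manifold_dim M) :=
  kink (u \o chart_inv (e n)) (chart_cod (e n)) i (ratr a) (ratr b) k.+1%:R^-1.
pose F (t : nat * 'I_(manifold_dim M) * rat * rat * nat) : set (borel M) :=
  let: (n, i, a, b, k) := t in
  if (ratr a < ratr b :> R) then chart_dom (e n) `&` e n @^-1` C n i a b k else set0.
have cC n i a b k : closed (C n i a b k).
  apply: kink_closed; first by rewrite invr_gt0 ltr0n.
  move=> p /set_mem ep U nU; exact: (chart_inv_nbhs ep (cu _ U nU)).
have mF t : measurable (F t).
  case: t => [[[[n i] a] b] k]; rewrite /F; case: ifP => // _.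
  exact: chart_preimage_measurable.
have F0 t : mu (F t) = 0%E.
  case: t => [[[[n i] a] b] k]; rewrite /F; case: ifP => [ab|]; last by rewrite measure0.
  apply: ac => //; first by apply: closed_borel.
  apply: (@lebesgue_rV_lines0 _ _ _ i); first by apply: closed_borel.
  by move=> v; apply: kink_lines0 => //; rewrite invr_gt0 ltr0n.
exists (\bigcup_t F t); split.
- by apply: countable_bigcupT_measurable => //; exact: countableP.
- exact: measure_bigcup_countType.
move=> x nN; have [n enx] := ex x; exists (e n); split => // i a b k ab Cx.
by apply: nN; exists (n, i, a, b, k) => //=; rewrite ab.
Qed.

End KinkNull.

(** * The contact set of the cost and the optimal potentials *)

Section Contact.
Context (R : realType) (m : nat) (M : 'I_m.+1 -> smoothManifold R)
  (mu : forall i, probability (borel (M i)) R).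
Hypothesis mu_compact : forall i, compactly_supported (mu i).
Context (c : mprod M -> R).
Hypothesis c_continuous : continuous c.
Context (v : family M).
Arguments v : clear implicits.
Hypotheses (hv : minorant mu c v) (pv : forall i, potential mu c (v i)).

Let K : set (borel (mprod M)) := spts mu.

Definition contact : set (borel (mprod M)) :=
  [set x : mprod M | spts mu x /\ \sum_i v i (x i) = c x].

Lemma contact_closed : closed (contact : set (mprod M)).
Proof.
have cs : continuous (fun x : mprod M => \sum_i v i (x i) - c x).
  move=> x; apply: cvgB; last exact: c_continuous.
  apply: (continuous_big (@add_continuous R^o) (F := fun i (x : mprod M) => v i (x i))) => i _ {}x.
  apply: (@continuous_comp _ _ _ (fun x : mprod M => x i) (v i)).
    exact: mprod_proj_continuous.
  exact: (potential_continuous mu_compact c_continuous (@pv i)).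
have -> : (contact : set (mprod M)) =
    spts mu `&` (fun x : mprod M => \sum_i v i (x i) - c x) @^-1` [set 0].
  apply/seteqP; split => x [Kx /= h]; split => //; first by rewrite h subrr.
  by apply/eqP; rewrite -subr_eq0 h.
apply: closedI; last by apply: closed_comp => //; exact: closed1.
apply: compact_closed; [exact: mprod_hausdorff|exact: spts_compact].
Qed.

(** The difference of c and the sum of the v_i is nonnegative on K with mean at most 0, so it
    vanishes almost everywhere. *)
Lemma contact_full (g : probability (borel (mprod M)) R) : coupling mu g ->
  mean g K c <= value mu v -> g (~` contact) = 0%E.
Proof.
move=> hg gv; have mK : measurable K by exact: spts_measurable.
have gK := coupling_spts hg.
have bc : bounded_measurable K c by exact: bounded_measurable_continuous.
have [bs sE] := value_mean mu_compact hg hv.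
pose w (x : borel (mprod M)) : R := c x + -1 * \sum_i v i ((x : mprod M) i).
have bw : bounded_measurable K w.
  by apply: bounded_measurableD => //; exact: (bounded_measurableZ _ bs).
have w0 x : K x -> 0 <= w x by move=> Kx; rewrite /w mulN1r subr_ge0; exact: hv.2.
have mw : mean g K w = 0.
  apply/eqP; rewrite eq_le; apply/andP; split.
    rewrite /w meanD//; last exact: (bounded_measurableZ _ bs).
    by rewrite meanZ// sE mulN1r subr_le0.
  rewrite -(mean_cst mK gK 0); apply: le_mean => //; exact: bounded_measurable_cst.
have iw : (\int[g]_(x in K) `|(w x)%:E| = 0)%E.
  rewrite (eq_integral (EFin \o w)); last first.
    by move=> x /set_mem Kx; rewrite gee0_abs ?lee_fin ?w0.
  have := mw; rewrite /mean /Rintegral => h.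
  rewrite -[LHS]fineK ?h//; apply: integrable_fin_num => //.
  exact: bounded_measurable_integrable.
have mw' : measurable_fun K (EFin \o w).
  by apply/measurable_EFinP; apply: measurable_funTS; exact: bw.1.
have wn := (ae_eq_integral_abs g mK mw').1 iw.
apply: measure_negligible; first by apply: measurableC; apply: closed_borel; exact: contact_closed.
have gKn : g.-negligible (~` K) by apply/negligibleP => //; exact: measurableC.
apply: negligibleS (negligibleU gKn wn) => x nW.
have [Kx|nK] := pselect (K x); last by left.
right => /= h; apply: nW; split => //.
by have := EFin_inj (h Kx); rewrite /w mulN1r => /eqP; rewrite subr_eq0 => /eqP.
Qed.

(** On the contact set the total cost separates into sums over each coordinate, which permutations
    preserve. The permuted points stay in the product K, where the minorant inequality holds. *)
Lemma contact_cyclically_monotone (S : set (mprod M)) :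
  S `<=` contact -> c_cyclically_monotone c S.
Proof.
move=> SW N x s Sx.
have Kx i : spts mu (x i) by have [] := SW _ (Sx i).
have -> : \sum_(i < N) c (x i) = \sum_(i < N) \sum_j v j (x (s j i) j).
  transitivity (\sum_(i < N) \sum_j v j (x i j)).
    by apply: eq_bigr => i _; have [_ <-] := SW _ (Sx i).
  rewrite exchange_big [RHS]exchange_big/=; apply: eq_bigr => j _.
  by rewrite (reindex_inj (@perm_inj _ (s j))).
by apply: ler_sum => i _; apply: hv.2 => j; exact: Kx.
Qed.

Hypothesis v_slice : forall (x : M ord0) y, spts mu y ->
  v ord0 x + \sum_(j | j != ord0) v j (y j) <= c (subst1 y x).
Hypotheses (c_semiconcave : semiconcave c) (c_twisted : twisted c).

Lemma contact_inj x y (e : chart R (manifold_dim (M ord0)) (M ord0)) :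
  contact x -> contact y -> (x : mprod M) ord0 = (y : mprod M) ord0 ->
  atlas e -> chart_dom e ((x : mprod M) ord0) ->
  (forall i (a b : rat) k, ratr a < ratr b :> R ->
    ~ kink (v ord0 \o chart_inv e) (chart_cod e) i (ratr a) (ratr b) k.+1%:R^-1
      (e ((x : mprod M) ord0))) ->
  x = y.
Proof.
move=> Wx Wy xy ae ex nk.
(* [v_slice] at q, minus the equality that holds at the base point because z is a contact point. *)
have touch z : contact z -> (z : mprod M) ord0 = (x : mprod M) ord0 ->
    forall q, chart_cod e q ->
    (v ord0 \o chart_inv e) q - (v ord0 \o chart_inv e) (e ((x : mprod M) ord0)) <=
    slice1 c e z q - slice1 c e z (e ((x : mprod M) ord0)).
  move=> [Kz zE] zx q _ /=; have := v_slice (chart_inv e q) Kz.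
  rewrite /slice1 chart_mapE// -zx -/(subst1 z _) -/(subst1 z (z ord0)) subst1_id.
  by move: zE; rewrite (bigD1 ord0)//=; lra.
have [K1 [r1 [r10 cf]]] := semiconcave_slice c_semiconcave ae ex.
have ey : chart_dom e ((y : mprod M) ord0) by rewrite -xy.
have [K2 [r2 [r20 cg]]] := semiconcave_slice c_semiconcave ae ey.
rewrite -xy in cg.
have pO : nbhs (e ((x : mprod M) ord0)) (chart_cod e).
  by apply: open_nbhs_nbhs; split; [exact: chart_cod_open|exact: chart_map_cod].
have [df dg dfg] := touch_differentiable r10 cf r20 cg pO (touch x Wx erefl)
  (touch y Wy (esym xy)) nk.
pose S : set (mprod M) := contact `&` [set z : mprod M | z ord0 = (x : mprod M) ord0].
apply: (@c_twisted _ S _ _ e ae ex x y) => //.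
- by move=> z [].
- by apply: contact_cyclically_monotone => z [].
Qed.

End Contact.

(** * Couplings carried by a graph over the first factor *)

Section Uniqueness.
Context (R : realType) (m : nat) (M : 'I_m.+1 -> smoothManifold R)
  (mu : forall i, probability (borel (M i)) R) (W : set (mprod M)) (N : set (borel (M ord0))).
Hypotheses (W_compact : compact W) (N_measurable : measurable N) (N0 : mu ord0 N = 0%E)
  (W_inj : forall x y, W x -> W y -> x ord0 = y ord0 -> ~ N (x ord0) -> x = y).

(** Outside the null set formed by the complement of W and the fibres over N, a point lies in A
    exactly when its first coordinate lies in the projection of W n A. That projection is compact,
    hence Borel. *)
Lemma graph_coupling_closed (g : probability (borel (mprod M)) R) (A : set (mprod M)) :
  coupling mu g -> g (~` W) = 0%E -> closed A ->
  g A = mu ord0 ((fun x : mprod M => x ord0) @` (W `&` A)).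
Proof.
move=> hg gW cA; set B := _ @` _.
have cB : closed B.
  apply: compact_closed; first exact: manifold_hausdorff.
  apply: continuous_compact; last exact: compact_closedI.
  by apply: continuous_subspaceT; exact: mprod_proj_continuous.
have mB : measurable (B : set (borel (M ord0))) by exact: closed_borel.
have mA : measurable (A : set (borel (mprod M))) by exact: closed_borel.
have mW : measurable (W : set (borel (mprod M))).
  by apply: closed_borel; apply: compact_closed => //; exact: mprod_hausdorff.
have mp (C : set (borel (M ord0))) : measurable C ->
    measurable ((fun x : mprod M => x ord0) @^-1` C : set (borel (mprod M))).
  by move=> mC; rewrite -[X in measurable X]setTI; exact: proj_measurable.
have gN : g ((fun x : mprod M => x ord0) @^-1` N) = 0%E by rewrite hg.
set E := ~` W `|` (fun x : mprod M => x ord0) @^-1` N.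
have mE : measurable (E : set (borel (mprod M))).
  by apply: measurableU; [exact: measurableC|exact: mp].
have gE : g E = 0%E by apply: null_set_setU => //; [exact: measurableC|exact: mp].
rewrite -(hg _ _ mB) -(measureU0 mA mE gE) -(measureU0 (mp _ mB) mE gE); congr (g _).
apply/seteqP; split => x [Ax|Ex]; [|by right| |by right].
  by have [Wx|nWx] := pselect (W x); [left; exists x|right; left].
have [y [Wy Ay] yx] := Ax; have [Wx|nWx] := pselect (W x); last by right; left.
have [Nx|nNx] := pselect (N (x ord0)); first by right; right.
by left; rewrite (W_inj Wx Wy).
Qed.

(** The formula for closed sets determines the measure of open sets, a generating family stable
    under intersection. *)
Lemma graph_coupling_unique (g h : probability (borel (mprod M)) R)
    (A : set (borel (mprod M))) :
  coupling mu g -> coupling mu h -> g (~` W) = 0%E -> h (~` W) = 0%E ->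
  measurable A -> g A = h A.
Proof.
move=> hg hh gW hW mA.
apply: (@measure_unique _ R (borel (mprod M)) (@open (mprod M)) (fun=> setT)) => //.
- by move=> U V; exact: openI.
- by move=> _; exact: openT.
- by apply/seteqP; split => // x _; exists 0%N.
- move=> U oU; rewrite -(setCK U).
  have mU : measurable (~` U : set (borel (mprod M))).
    by apply: closed_borel; exact: open_closedC.
  apply: etrans (probability_setC g mU) _; apply: etrans _ (esym (probability_setC h mU)).
  congr (_ - _)%E.
  apply: etrans (graph_coupling_closed hg gW (open_closedC oU)) _.
  exact: esym (graph_coupling_closed hh hW (open_closedC oU)).
- by move=> k; rewrite (le_lt_trans (probability_le1 _ _))// ltry.
Qed.

Lemma graph_exists : exists T : M ord0 -> forall j : 'I_m, M (lift ord0 j),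
  ~` graph T `<=` ~` W `|` (fun x : mprod M => x ord0) @^-1` N.
Proof.
pose x0 : mprod M := point.
have /choice[s sW] (p : M ord0) : exists y : mprod M,
    forall x, W x -> x ord0 = p -> ~ N p -> x = y.
  have [[y [Wy yp nNp]]|n] := pselect (exists y, [/\ W y, y ord0 = p & ~ N p]).
    by exists y => x Wx xp _; apply: W_inj; rewrite ?xp.
  (* Over N, or where W has no point, the map takes an arbitrary default value. *)
  by exists x0 => x Wx xp nNp; case: n; exists x.
exists (fun p j => s p (lift ord0 j)) => x nG.
have [Wx|nWx] := pselect (W x); last by left.
have [Nx|nNx] := pselect (N (x ord0)); first by right.
by case: nG => j; rewrite -(sW _ x Wx erefl nNx).
Qed.

End Uniqueness.

Theorem corollary3p2 (R : realType) (m : nat)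
  (M : 'I_m.+1 -> smoothManifold R)
  (mu : forall i, probability (borel (M i)) R)
  (c : mprod M -> R)
  (mu_compact : forall i, compactly_supported (mu i))
  (c_continuous : continuous c)
  (c_semiconcave : semiconcave c)
  (c_twisted : twisted c)
  (mu1_ac : ac_in_charts (mu ord0)) :
  exists gamma : probability (borel (mprod M)) R,
    [/\ kantorovich_solution c mu gamma,
        induces_monge gamma &
        forall gamma' : probability (borel (mprod M)) R,
          kantorovich_solution c mu gamma' ->
          forall A : set (borel (mprod M)), measurable A -> gamma' A = gamma A].
Proof.
have [v [hv pv Dv v_slice]] := dual_attained mu_compact c_continuous.
have [gamma [hgamma gammaD]] := plan_exists mu_compact c_continuous.
have [N [mN N0 Nk]] := kinks_null mu1_ac
  (potential_continuous mu_compact c_continuous (@pv ord0)).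
pose W : set (mprod M) := contact mu c v.
have W_compact : compact W.
  rewrite -(setIidr (A := spts mu) (B := W)); last by move=> x [].
  apply: compact_closedI; first exact: spts_compact.
  exact: (contact_closed mu_compact c_continuous pv).
have W_inj x y : W x -> W y -> x ord0 = y ord0 -> ~ N (x ord0) -> x = y.
  move=> Wx Wy xy /Nk[e [ae ex nk]].
  exact: (contact_inj hv v_slice c_semiconcave c_twisted Wx Wy xy ae ex nk).
have optW g : coupling mu g -> mean g (spts mu) c <= value mu v -> g (~` W) = 0%E.
  exact: (contact_full mu_compact c_continuous hv pv).
have gammaW : gamma (~` W) = 0%E by apply: optW => //; rewrite gammaD.
exists gamma; split.
- split => // g hg; rewrite !(cost_mean mu_compact c_continuous)// lee_fin gammaD.
  exact: le_trans Dv (weak_duality mu_compact c_continuous hg hv).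
- have [T hT] := graph_exists W_inj.
  exists T; apply: (@negligibleS _ (borel (mprod M)) R gamma _ _ hT); apply: negligibleU.
    apply/negligibleP => //; apply: measurableC; apply: closed_borel.
    exact: (contact_closed mu_compact c_continuous pv).
  have mpN : measurable ((fun x : mprod M => x ord0) @^-1` N : set (borel (mprod M))).
    by rewrite -[X in measurable X]setTI; exact: proj_measurable.
  by apply/negligibleP => //; exact: etrans (hgamma _ _ mN) N0.
move=> g [hg gopt] A mA; apply: (graph_coupling_unique W_compact mN N0 W_inj) => //.
(* Another minimizer costs no more than [gamma], hence no more than the value of v, so it is carried
   by W as well. *)
apply: optW => //; apply: le_trans Dv; rewrite -gammaD -lee_fin.
by rewrite -!(cost_mean mu_compact c_continuous)//; exact: gopt.
Qed.
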